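(* Let $\mathbb{K}$ be a number field with $n=n_{\mathbb{K}}\geq 2$. For every $w>0$, \[ |K(w)|\leq Q_2(n)|\Delta_{\mathbb{K}}|^{1+\frac{1}{2n}}w^{n-\frac12-\frac{1}{2n}},\qquad |K^{(n)}(w)|\leq Q_3(n)|\Delta_{\mathbb{K}}|^{\frac{1}{2n}}w^{\frac12-\frac{1}{2n}}, \] where \[ Q_2(n)=2^{\frac32}\pi^{-\frac n2-\frac32}e^{4n-\frac12}\sqrt{3n},\qquad Q_3(n)=2^{n+\frac32}\pi^{\frac n2-\frac32}e^{n\left(1+\frac{4n}{n-1}\right)-\frac12}\sqrt{3n}. \]
   Context: Let $\mathbb{K}$ be a number field of degree $n=n_{\mathbb{K}}=r_1+2r_2$, where $r_1$ and $r_2$ are the numbers of real and complex places, and let $\Delta_{\mathbb{K}}$ be its discriminant. Define \[ f(s)=\left(\frac{2^{1-s}}{\pi^s}\right)^{n}|\Delta_{\mathbb{K}}|^{s-\frac12}\left(\cos\frac{\pi s}{2}\right)^{r_1+r_2}\left(\sin\frac{\pi s}{2}\right)^{r_2}\Gamma(s)^{n} \] (so that $\zeta_{\mathbb{K}}(1-s)=f(s)\zeta_{\mathbb{K}}(s)$). For $w>0$ define, with vertical-line integrals understood as $\lim_{T\to\infty}\int_{c-iT}^{c+iT}$, \[ K(w)=\frac{1}{2\pi i}\int_{-\frac12-\frac{1}{2n}-i\infty}^{-\frac12-\frac{1}{2n}+i\infty}\frac{w^{s+n}}{s(s+1)\cdots(s+n)}f(s)^{-1}\,ds, \qquad K^{(n)}(w)=\frac{1}{2\pi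 i}\int_{\frac12-\frac{1}{2n}-i\infty}^{\frac12-\frac{1}{2n}+i\infty}\frac{w^{s}}{s}f(s)^{-1}\,ds, \] the latter being the $n$-th derivative of $K$. *)

(* Defs.v *)
(* Number fields are MathComp objects; the analysis is over Stdlib's R and
   Coquelicot's C.  The two parts meet only in [nat] and [int] invariants. *)
From mathcomp Require Import all_boot all_order all_algebra all_field.
From Stdlib Require Import Reals.
From Coquelicot Require Import Coquelicot.

Set Implicit Arguments.
Unset Strict Implicit.
Unset Printing Implicit Defensive.

Local Open Scope ring_scope.

(* A number field is a [fieldExtType rat] and its degree is [\dim {:K}].
   As K is algebraic over the rationals, its complex embeddings all take
   their values in algC; they are counted up to pointwise equality. *)
Definition embedding_count (K : fieldExtType rat)
    (P : {rmorphism K -> algC} -> Prop) (m : nat) : Prop :=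
  exists phi : 'I_m -> {rmorphism K -> algC},
    [/\ forall i, P (phi i),
        forall i j, phi i =1 phi j -> i = j
      & forall psi : {rmorphism K -> algC}, P psi -> exists i, psi =1 phi i].

Definition real_embedding (K : fieldExtType rat)
    (phi : {rmorphism K -> algC}) : Prop :=
  forall x, phi x \is Num.real.

(* Real places are real embeddings; complex places are pairs of conjugate
   non-real embeddings. *)
Definition has_signature (K : fieldExtType rat) (r1 r2 : nat) : Prop :=
  embedding_count (@real_embedding K) r1 /\
  embedding_count (fun phi : {rmorphism K -> algC} => ~ real_embedding phi) r2.*2.

Definition field_trace (K : fieldExtType rat) (x : K) : rat :=
  \tr (passmx.mxof (vbasis {:K}) (vbasis {:K}) (amulr x)).

Definition integral_basis (K : fieldExtType rat)
    (b : (\dim {:K}).-tuple K) : Prop :=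
  basis_of {:K} b /\
  forall x : K, integralOver (intr : int -> K) x <-> inIntSpan b x.

Definition is_discriminant (K : fieldExtType rat) (D : int) : Prop :=
  exists2 b : (\dim {:K}).-tuple K, integral_basis b &
    D%:~R = \det (\matrix_(i < \dim {:K}, j < \dim {:K})
                     field_trace (b`_i * b`_j)).

Local Open Scope R_scope.
Local Open Scope C_scope.

Definition cexp (z : C) : C :=
  ((exp (Re z) * cos (Im z))%R, (exp (Re z) * sin (Im z))%R).

Definition ccos (z : C) : C := (cexp (Ci * z) + cexp (- (Ci * z))) / RtoC 2.

Definition csin (z : C) : C :=
  (cexp (Ci * z) - cexp (- (Ci * z))) / (RtoC 2 * Ci).

(* Principal power a^s, meaningful for a > 0 only. *)
Definition rcpow (a : R) (s : C) : C := cexp (s * RtoC (ln a)).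

(* rising s k = s (s + 1) ... (s + k - 1) *)
Fixpoint rising (s : C) (k : nat) : C :=
  match k with
  | O => RtoC 1
  | S j => rising s j * (s + RtoC (INR j))
  end.

(* Euler's limit  Gamma(s) = lim_k  k! k^s / (s (s + 1) ... (s + k)),  valid at
   every s that is not a nonpositive integer, hence also for Re s <= 0 where
   the Euler integral diverges. *)
Definition gamma_seq (s : C) (k : nat) : C :=
  RtoC (INR (Factorial.fact k)) * rcpow (INR k) s / rising s k.+1.

Definition Gamma (s : C) : C :=
  (real (Lim_seq (fun k => Re (gamma_seq s k))),
   real (Lim_seq (fun k => Im (gamma_seq s k)))).

(* The factor of zeta_K(1 - s) = f(s) zeta_K(s), for a field of degree n,
   signature (r1, r2) and discriminant D. *)
Definition fe_factor (n r1 r2 : nat) (D : int) (s : C) : C :=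
  (rcpow 2 (RtoC 1 - s) / rcpow PI s) ^ n
  * rcpow (INR (absz D)) (s - RtoC (1 / 2))
  * ccos (RtoC PI * s / RtoC 2) ^ (r1 + r2)
  * csin (RtoC PI * s / RtoC 2) ^ r2
  * Gamma s ^ n.

(* l is the limit as T tends to +oo of the integral of g along the segment
   from c - iT to c + iT; the parametrisation s = c + it gives ds = i dt. *)
Definition is_vline_integral (g : C -> C) (c : R) (l : C) : Prop :=
  exists J : R -> C,
    (forall T : R, (0 < T)%R ->
       is_RInt (V := C_R_NormedModule)
         (fun t : R => g (RtoC c + Ci * RtoC t) * Ci) (- T)%R T (J T)) /\
    filterlim J (Rbar_locally p_infty) (locally l).

(* [is_kernel ... w k] : the integral defining K(w) converges and K(w) = k. *)
Definition is_kernel (n r1 r2 : nat) (D : int) (w : R) (k : C) : Prop :=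
  exists2 l : C,
    is_vline_integral
      (fun s => rcpow w (s + RtoC (INR n)) / rising s n.+1
                * / fe_factor n r1 r2 D s)
      (- (1 / 2) - 1 / (2 * INR n))%R l
    & k = / (RtoC 2 * RtoC PI * Ci) * l.

(* Same for the n-th derivative of the kernel, through its own integral. *)
Definition is_kernel_deriv (n r1 r2 : nat) (D : int) (w : R) (k : C) : Prop :=
  exists2 l : C,
    is_vline_integral
      (fun s => rcpow w s / s * / fe_factor n r1 r2 D s)
      (1 / 2 - 1 / (2 * INR n))%R l
    & k = / (RtoC 2 * RtoC PI * Ci) * l.

Definition Q2 (n : nat) : R :=
  (Rpower 2 (3 / 2) * Rpower PI (- (INR n / 2) - 3 / 2)
   * exp (4 * INR n - 1 / 2) * sqrt (3 * INR n))%R.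

Definition Q3 (n : nat) : R :=
  (Rpower 2 (INR n + 3 / 2) * Rpower PI (INR n / 2 - 3 / 2)
   * exp (INR n * (1 + 4 * INR n / (INR n - 1)) - 1 / 2)
   * sqrt (3 * INR n))%R.

(* Main.v *)
(* K(w) is the limit of symmetric vertical integrals of a function [H] with
   [H (conj s) = conj (H s)], so everything reduces to the improper real integral
   of [Re H] over a half-line, where [|H|] only decays like [t^(-1/2)].

   Near the real axis one uses that bound.  It comes from a quantitative Stirling
   formula with no reference to the constant [log (2 pi) / 2]: Euler's product
   telescopes against [lam z = (z - 1/2) log z - z] with errors [del z = O(1/|z|^2)],
   whence [Gamma s = exp (lam z + c + Dl z) / (s (s + 1))] with [z = s + 2].

   Far away, i.e. for [t >= 25 n^2], the same formula shows that
   [H = A t^(-1/2) exp (i phi(t)) (1 + O(n^2/t))] with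
   [phi(t) = n t (log (t0/t) + 1) + const]: this needs [r1 + 2 r2 = n] to cancel the
   exponential growths.  The error term is absolutely integrable, and the main term
   has integral bounded independently of the stationary point [t0], the window
   [|t - t0| <= sqrt t0] being estimated trivially and the rest by parts.

   All losses are of the form [C^n], which the factor [e^(4n)] absorbs. *)
Require Import Defs.
From Stdlib Require Import Reals Lra Lia Psatz.
From Coquelicot Require Import Coquelicot.

Local Open Scope R_scope.

(** * An oscillatory integral *)

(** Both abscissas [sg] satisfy [n (1/2 - sg) = p + 1/2], with [p = n] for the kernel and [p = 0]
    for its derivative. That equation is the source of the decay [t^(-1/2)], and on such a line the
    modulus of the integrand already carries the exact powers of [w] and [|D|]. What remains is to
    bound a conditionally convergent integral by a constant depending on [n] alone.

    The obstacle is uniformity: the stationary point is [2 pi (w / |D|)^(1/n)], which can lie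
    anywhere on the half-line, so the oscillatory estimate must hold with one constant for every
    [t0].

    The crossover [25 n^2] balances two demands. Beyond it the relative error, of exponent
    [10 n^2 / t], must be small; below it the integral is bounded without any cancellation, at a
    cost close to [2 sqrt (25 n^2) = 10 n]. The whole loss is the linear factor [18 n + 13]. *)

(** [K + G] and [K - G] are nondecreasing. With an explicit [K] this gives Taylor remainders and
    integral bounds without computing any integral. *)
Lemma Rabs_incr_le_derive (G K g k : R -> R) (a b : R) :
  a <= b ->
  (forall t, a <= t <= b -> is_derive G t (g t)) ->
  (forall t, a <= t <= b -> is_derive K t (k t)) ->
  (forall t, a <= t <= b -> Rabs (g t) <= k t) ->
  Rabs (G b - G a) <= K b - K a.
Proof.
intros ab dG dK gk.
assert (incr : forall H h, (forall t, a <= t <= b -> is_derive H t (h t)) ->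
   (forall t, a <= t <= b -> 0 <= h t) -> H a <= H b).
{ intros H h dH h0.
  destruct (MVT_gen H a b h) as [c [cab e]].
  - intros x; rewrite Rmin_left, Rmax_right by lra; intros; apply dH; lra.
  - intros x; rewrite Rmin_left, Rmax_right by lra; intros hx.
    apply continuity_pt_filterlim, (ex_derive_continuous H x).
    exists (h x); apply dH; lra.
  - rewrite Rmin_left, Rmax_right in cab by lra.
    specialize (h0 c cab); nra. }
apply Rabs_le; split.
- enough (K a + G a <= K b + G b) by lra.
  apply (incr (fun t => K t + G t) (fun t => k t + g t)); intros t ht.
  + apply (is_derive_plus K G); auto.
  + generalize (gk t ht); unfold Rabs; destruct Rcase_abs; lra.
- enough (K a - G a <= K b - G b) by lra.
  apply (incr (fun t => K t - G t) (fun t => k t - g t)); intros t ht.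
  + apply (is_derive_minus K G); auto.
  + generalize (gk t ht); unfold Rabs; destruct Rcase_abs; lra.
Qed.

Lemma ln_le_sub1 (x : R) : 0 < x -> ln x <= x - 1.
Proof.
intros x0; destruct (Req_dec x 1) as [->|ne]; [rewrite ln_1; lra|].
assert (h := exp_ineq1 (ln x)); rewrite exp_ln in h by lra.
enough (ln x <> 0) by (specialize (h H); lra).
intros e; apply ne; rewrite <- (exp_ln x x0), e; apply exp_0.
Qed.

Lemma ln_sub_ge (x y : R) : 0 < x -> 0 < y -> 1 - y / x <= ln x - ln y.
Proof.
intros x0 y0; assert (h := ln_le_sub1 (y / x) (Rdiv_lt_0_compat _ _ y0 x0)).
rewrite ln_div in h by lra; lra.
Qed.

(* The phase has derivative [N * (ln t0 - ln t)], stationary at [t0]. *)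
Definition osc (N t0 al t : R) : R :=
  cos (N * t * (ln t0 - ln t + 1) + al) / sqrt t.

(** The amplitude [1 / sqrt t] divided by the derivative of the phase: the coefficient of the sine
    when [osc] is integrated by parts. *)
Definition osc_weight (N t0 t : R) : R :=
  / (N * (ln t0 - ln t) * sqrt t).

Lemma continuous_osc N t0 al t : 0 < t -> continuous (osc N t0 al) t.
Proof.
intros ht; apply (ex_derive_continuous (osc N t0 al)); unfold osc.
auto_derive; repeat split; trivial.
assert (h := sqrt_lt_R0 t ht); lra.
Qed.

Lemma ex_RInt_osc N t0 al a b : 0 < a <= b -> ex_RInt (osc N t0 al) a b.
Proof.
intros hab; apply (ex_RInt_continuous (V := R_CompleteNormedModule)).
intros z; rewrite Rmin_left, Rmax_right by lra; intros; apply continuous_osc; lra.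
Qed.

Lemma Rabs_osc_le N t0 al t : 0 < t -> Rabs (osc N t0 al t) <= / sqrt t.
Proof.
intros ht; assert (h := sqrt_lt_R0 t ht).
unfold osc, Rdiv; rewrite Rabs_mult, (Rabs_pos_eq (/ sqrt t)).
2: now apply Rlt_le, Rinv_0_lt_compat.
rewrite <- (Rmult_1_l (/ sqrt t)) at 2; apply Rmult_le_compat_r.
- now apply Rlt_le, Rinv_0_lt_compat.
- apply Rabs_le; generalize (COS_bound (N * t * (ln t0 - ln t + 1) + al)); lra.
Qed.

(* [s] records the direction in which the weight is monotone. *)
Lemma osc_by_parts (N t0 al a b s : R) :
  0 < N -> 0 < a <= b -> (s = 1 \/ s = -1) ->
  (forall t, a <= t <= b -> ln t0 - ln t <> 0) ->
  (forall t, a <= t <= b -> 0 <= s * (2 - (ln t0 - ln t))) ->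
  Rabs (RInt (osc N t0 al) a b) <=
    Rabs (osc_weight N t0 b) + Rabs (osc_weight N t0 a)
    + s * (osc_weight N t0 b - osc_weight N t0 a).
Proof.
intros N0 hab hs hl hm.
set (k := osc_weight N t0).
set (ph := fun t => N * t * (ln t0 - ln t + 1) + al).
(* The numerator is [N / 2] times [2 - (ln t0 - ln t)], so away from [t0] the weight changes
   direction only at [t0 exp (-2)]. *)
set (k' := fun t => (N - N * (ln t0 - ln t) / 2)
                    / ((N * (ln t0 - ln t)) ^ 2 * (t * sqrt t))).
assert (dk : forall t, a <= t <= b -> is_derive k t (k' t)).
{ intros t ht; assert (t0' : 0 < t) by lra; assert (st := sqrt_lt_R0 t t0').
  assert (l0 := hl t ht); assert (ss := sqrt_sqrt t (Rlt_le _ _ t0')).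
  unfold k, osc_weight; auto_derive.
  - repeat split; trivial; apply Rmult_integral_contrapositive; split; [|lra].
    apply Rmult_integral_contrapositive; split; lra.
  - unfold k'; set (q := sqrt t) in *; rewrite <- ss; field.
    rewrite ss; repeat split; try exact l0; lra. }
assert (dks : forall t, a <= t <= b ->
   is_derive (fun t => k t * sin (ph t)) t (k' t * sin (ph t) + osc N t0 al t)).
{ intros t ht; assert (t0' : 0 < t) by lra; assert (st := sqrt_lt_R0 t t0').
  assert (l0 := hl t ht).
  assert (dp : is_derive ph t (N * (ln t0 - ln t))).
  { unfold ph; auto_derive; [lra|field; lra]. }
  assert (ds : is_derive (fun t => sin (ph t)) t (N * (ln t0 - ln t) * cos (ph t))).
  { apply (is_derive_comp sin ph); [apply is_derive_sin|exact dp]. }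
  evar_last.
  - apply (is_derive_mult k (fun t => sin (ph t))); [now apply dk|exact ds|].
    intros; apply Rmult_comm.
  - unfold plus, mult; simpl; unfold k, osc_weight, osc, ph; field.
    repeat split; lra. }
(* Subtracting the boundary term leaves the derivative [- k' sin ph], dominated by [s k'] since [k']
   has constant sign. The remaining integral thus costs only the variation of the weight. *)
set (G := fun t => RInt (osc N t0 al) a t - k t * sin (ph t)).
assert (dG : forall t, a <= t <= b -> is_derive G t (- (k' t * sin (ph t)))).
{ intros t ht; unfold G; evar_last.
  - apply (is_derive_minus (fun t => RInt (osc N t0 al) a t)
             (fun t => k t * sin (ph t))); [|now apply dks].
    apply (is_derive_RInt (osc N t0 al) (fun t => RInt (osc N t0 al) a t) a).
    + assert (e0 : 0 < t / 2) by lra; exists (mkposreal _ e0); intros y hy.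
      assert (hy' : Rabs (y - t) < t / 2) by exact hy.
      apply Rabs_def2 in hy'.
      apply (RInt_correct (V := R_CompleteNormedModule)).
      apply (ex_RInt_continuous (V := R_CompleteNormedModule)); intros z hz.
      apply continuous_osc; destruct (Rle_dec a y).
      * rewrite Rmin_left in hz by lra; lra.
      * rewrite Rmin_right in hz by lra; lra.
    + apply continuous_osc; lra.
  - unfold minus, plus, opp; simpl; ring. }
assert (hG : Rabs (G b - G a) <= s * k b - s * k a).
{ apply (Rabs_incr_le_derive G (fun t => s * k t) (fun t => - (k' t * sin (ph t)))
           (fun t => s * k' t)); [lra|exact dG| |].
  - intros t ht; apply (is_derive_scal k t s); now apply dk.
  - intros t ht; rewrite Rabs_Ropp, Rabs_mult.
    assert (pos : 0 < (N * (ln t0 - ln t)) ^ 2 * (t * sqrt t)).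
    { assert (l0 := hl t ht); assert (st := sqrt_lt_R0 t ltac:(lra)).
      apply Rmult_lt_0_compat; [|nra].
      apply pow2_gt_0, Rmult_integral_contrapositive; split; lra. }
    assert (sk : 0 <= s * k' t).
    { unfold k'; replace (s * _) with (s * (2 - (ln t0 - ln t)) * (N / 2)
        / ((N * (ln t0 - ln t)) ^ 2 * (t * sqrt t))).
      - apply Rdiv_le_0_compat; [|exact pos].
        apply Rmult_le_pos; [now apply hm|lra].
      - field; repeat split; try lra.
        + assert (st := sqrt_lt_R0 t ltac:(lra)); lra.
        + now apply hl. }
    assert (hk : Rabs (k' t) = s * k' t).
    { destruct hs as [-> | ->].
      - rewrite Rabs_pos_eq; lra.
      - rewrite Rabs_left1; lra. }
    rewrite hk; rewrite <- (Rmult_1_r (s * k' t)) at 2.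
    apply Rmult_le_compat_l; [exact sk|].
    apply Rabs_le; generalize (SIN_bound (ph t)); lra. }
assert (e : @eq R (RInt (osc N t0 al) a b)
            ((G b - G a) + k b * sin (ph b) - k a * sin (ph a))).
{ unfold G; assert (z : RInt (osc N t0 al) a a = 0) by apply (RInt_point a (osc N t0 al)).
  rewrite z; lra. }
assert (bnd : forall t, Rabs (k t * sin (ph t)) <= Rabs (k t)).
{ intros t; rewrite Rabs_mult; rewrite <- (Rmult_1_r (Rabs (k t))) at 2.
  apply Rmult_le_compat_l; [apply Rabs_pos|].
  apply Rabs_le; generalize (SIN_bound (ph t)); lra. }
rewrite e; assert (ba := bnd a); assert (bb := bnd b).
revert hG ba bb; unfold Rabs; repeat destruct Rcase_abs; lra.
Qed.

(** The cut [c] may fall outside [[a, b]], since the cuts used below follow the stationary point.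
    The hypotheses cover all subintervals so that cuts can be nested. *)
Lemma Rabs_RInt_cut (f : R -> R) (a b c C1 C2 : R) :
  a <= b -> ex_RInt f a b -> 0 <= C1 -> 0 <= C2 ->
  (forall x y, a <= x <= y -> y <= b -> y <= c -> Rabs (RInt f x y) <= C1) ->
  (forall x y, a <= x <= y -> y <= b -> c <= x -> Rabs (RInt f x y) <= C2) ->
  Rabs (RInt f a b) <= C1 + C2.
Proof.
intros ab ef p1 p2 h1 h2.
destruct (Rle_dec b c) as [bc|bc].
{ assert (h := h1 a b ltac:(lra) ltac:(lra) bc); lra. }
destruct (Rle_dec c a) as [ca|ca].
{ assert (h := h2 a b ltac:(lra) ltac:(lra) ca); lra. }
assert (h := h1 a c ltac:(lra) ltac:(lra) ltac:(lra)).
assert (h' := h2 c b ltac:(lra) ltac:(lra) ltac:(lra)).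
rewrite <- (RInt_Chasles f a c b).
- eapply Rle_trans; [apply Rabs_triang|lra].
- apply (ex_RInt_Chasles_1 (V := R_CompleteNormedModule) f a c b); [lra|exact ef].
- apply (ex_RInt_Chasles_2 (V := R_CompleteNormedModule) f a c b); [lra|exact ef].
Qed.

(** Beyond the stationary point the weight is negative and increasing, so boundary terms and
    variation add up to twice its size at [a], where [ln a - ln t0 >= 1 - t0 / a]. *)
Lemma osc_above (N t0 al a b : R) :
  1 <= N -> 0 < t0 -> t0 < a <= b ->
  Rabs (RInt (osc N t0 al) a b) <= 2 / ((1 - t0 / a) * sqrt a).
Proof.
intros N1 t00 hab.
assert (neg : forall t, a <= t <= b -> ln t0 - ln t < 0).
{ intros t ht; enough (ln t0 < ln t) by lra; apply ln_increasing; lra. }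
assert (wneg : forall t, a <= t <= b -> osc_weight N t0 t < 0).
{ intros t ht; apply Rinv_lt_0_compat; assert (n := neg t ht).
  assert (s := sqrt_lt_R0 t ltac:(lra)).
  enough (0 < N * - (ln t0 - ln t) * sqrt t) by lra.
  repeat apply Rmult_lt_0_compat; lra. }
eapply Rle_trans; [apply (osc_by_parts N t0 al a b 1)|].
- lra.
- lra.
- now left.
- intros t ht; assert (n := neg t ht); lra.
- intros t ht; assert (n := neg t ht); lra.
- assert (wa := wneg a ltac:(lra)); assert (wb := wneg b ltac:(lra)).
  rewrite !Rabs_left by lra.
  apply Rle_trans with (2 * - osc_weight N t0 a); [lra|].
  assert (s := sqrt_lt_R0 a ltac:(lra)).
  assert (l := ln_sub_ge a t0 ltac:(lra) ltac:(lra)).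
  assert (0 < 1 - t0 / a).
  { enough (t0 / a < 1) by lra; apply (Rmult_lt_reg_r a); [lra|].
    field_simplify; lra. }
  unfold Rdiv; apply Rmult_le_compat_l; [lra|].
  unfold osc_weight; rewrite <- Rinv_opp.
  apply Rinv_le_contravar; [now apply Rmult_lt_0_compat|].
  replace (- (N * (ln t0 - ln a) * sqrt a)) with (N * (ln a - ln t0) * sqrt a) by ring.
  apply Rmult_le_compat_r; [lra|]; nra.
Qed.

(** With [s = -1], for intervals before [t0 exp (-2)], only the left end counts; with [s = 1],
    between that point and [t0], only the right end. *)
Lemma osc_below (N t0 al a b s : R) :
  1 <= N -> 0 < a <= b -> b < t0 -> (s = 1 \/ s = -1) ->
  (forall t, a <= t <= b -> 0 <= s * (2 - (ln t0 - ln t))) ->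
  Rabs (RInt (osc N t0 al) a b) <=
    (1 - s) * osc_weight N t0 a + (1 + s) * osc_weight N t0 b
  /\ 0 < osc_weight N t0 a /\ 0 < osc_weight N t0 b.
Proof.
intros N1 hab bt hs hm.
assert (pos : forall t, a <= t <= b -> 0 < ln t0 - ln t).
{ intros t ht; enough (ln t < ln t0) by lra; apply ln_increasing; lra. }
assert (wpos : forall t, a <= t <= b -> 0 < osc_weight N t0 t).
{ intros t ht; apply Rinv_0_lt_compat; assert (p := pos t ht).
  assert (q := sqrt_lt_R0 t ltac:(lra)).
  repeat apply Rmult_lt_0_compat; lra. }
assert (wa := wpos a ltac:(lra)); assert (wb := wpos b ltac:(lra)).
split; [|split; assumption].
eapply Rle_trans; [apply (osc_by_parts N t0 al a b s)|]; try assumption; try lra.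
- intros t ht; assert (p := pos t ht); lra.
- rewrite !Rabs_pos_eq by lra; lra.
Qed.

(** The shares of [13 = 1 + 6 + 3 + 3] belong to the ranges up to [t0 exp (-2)], from there to
    [t0 - sqrt t0], the window up to [t0 + sqrt t0], and the rest. *)
Lemma Rabs_RInt_osc_le (N t0 al a b : R) :
  1 <= N -> 0 < t0 -> 100 <= a <= b -> Rabs (RInt (osc N t0 al) a b) <= 13.
Proof.
intros N1 t00 hab.
assert (q0 := sqrt_lt_R0 t0 t00).
assert (qq := sqrt_sqrt t0 (Rlt_le _ _ t00)).
assert (ei : forall x y, a <= x <= y -> ex_RInt (osc N t0 al) x y).
{ intros; apply ex_RInt_osc; lra. }
assert (s10 : forall x, a <= x -> 10 <= sqrt x /\ sqrt x * sqrt x = x).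
{ intros x hx; split; [|apply sqrt_sqrt; lra].
  replace 10 with (sqrt 100); [apply sqrt_le_1_alt; lra|].
  replace 100 with (10 * 10) by ring; apply sqrt_square; lra. }
replace 13 with (1 + (6 + (3 + 3))) by ring.
assert (te : 0 < t0 * exp (-2) < t0).
{ assert (e := exp_pos (-2)); split; [nra|].
  assert (e1 : exp (-2) < exp 0) by (apply exp_increasing; lra).
  rewrite exp_0 in e1; nra. }
assert (le : ln (t0 * exp (-2)) = ln t0 - 2).
{ rewrite ln_mult by (lra || apply exp_pos); rewrite ln_exp; lra. }
apply (Rabs_RInt_cut _ a b (t0 * exp (-2))); try lra; [now apply ei| |].
{ intros x y hxy hy hc.
  destruct (osc_below N t0 al x y (-1) N1 ltac:(lra) ltac:(lra) (or_intror eq_refl))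
    as [h [wx wy]].
  - intros t ht; enough (ln t <= ln (t0 * exp (-2))) by lra.
    apply ln_le; lra.
  - destruct (s10 x ltac:(lra)) as [sx ssx].
    assert (lx : 2 <= ln t0 - ln x).
    { enough (ln x <= ln (t0 * exp (-2))) by lra; apply ln_le; lra. }
    enough (osc_weight N t0 x <= / 2) by lra.
    apply Rinv_le_contravar; [lra|].
    apply Rle_trans with (1 * 2 * 10); [lra|].
    repeat apply Rmult_le_compat; lra. }
intros a1 b1 h1 hb1 hc1.
apply (Rabs_RInt_cut _ a1 b1 (t0 - sqrt t0)); try lra; [apply ei; lra| |].
{ intros x y hxy hy hc.
  assert (l2 : forall t, x <= t -> ln t0 - ln t <= 2).
  { intros t ht; enough (ln (t0 * exp (-2)) <= ln t) by lra; apply ln_le; lra. }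
  destruct (osc_below N t0 al x y 1 N1 ltac:(lra) ltac:(lra) (or_introl eq_refl))
    as [h [wx wy]].
  - intros t ht; assert (l := l2 t ltac:(lra)); lra.
  - destruct (s10 y ltac:(lra)) as [sy ssy].
    enough (osc_weight N t0 y <= / / 3) by lra.
    apply Rinv_le_contravar; [lra|].
    assert (ly := ln_sub_ge t0 y ltac:(lra) ltac:(lra)).
    (* On this range [t0 <= exp 2 * y], so passing from [sqrt y] to [sqrt t0] costs at most a factor
       3. *)
    assert (y9 : t0 <= 9 * y).
    { assert (l := l2 y ltac:(lra)).
      assert (e2 : exp (ln t0) <= exp (ln y + 2)) by
        (destruct (Req_dec (ln t0) (ln y + 2)) as [->|]; [lra|];
         left; apply exp_increasing; lra).
      rewrite exp_plus, !exp_ln in e2 by lra.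
      replace 2 with (1 + 1) in e2 by ring; rewrite exp_plus in e2.
      assert (e3 := exp_le_3); assert (e0 := exp_pos 1).
      assert (exp 1 * exp 1 <= 9) by nra; nra. }
    assert (q3 : sqrt t0 <= 3 * sqrt y) by nra.
    assert (ratio : / sqrt t0 <= 1 - y / t0).
    { apply (Rmult_le_reg_r t0); [lra|].
      replace (/ sqrt t0 * t0) with (sqrt t0) by (rewrite <- qq at 3; field; lra).
      replace ((1 - y / t0) * t0) with (t0 - y) by (field; lra); lra. }
    assert (ip := Rinv_0_lt_compat _ q0).
    apply Rle_trans with (1 * / sqrt t0 * sqrt y).
    + apply (Rmult_le_reg_r (sqrt t0)); [lra|]; field_simplify; lra.
    + apply Rmult_le_compat_r; [lra|]; apply Rmult_le_compat; lra. }
intros a2 b2 h2 hb2 hc2.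
apply (Rabs_RInt_cut _ a2 b2 (t0 + sqrt t0)); try lra; [apply ei; lra| |].
{ intros x y hxy hy hc.
  destruct (s10 x ltac:(lra)) as [sx ssx].
  apply Rle_trans with ((y - x) * / sqrt x).
  - apply abs_RInt_le_const; [lra|apply ei; lra|].
    intros t ht; eapply Rle_trans; [apply Rabs_osc_le; lra|].
    apply Rinv_le_contravar; [lra|]; apply sqrt_le_1_alt; lra.
  (* The window has length at most [2 sqrt t0]. The inequality holds for [sqrt t0 >= 2] because
     [x >= t0 - sqrt t0], and otherwise because [x >= 100]. *)
  - assert (9 * x >= 4 * (sqrt t0 * sqrt t0)).
    { destruct (Rle_dec 2 (sqrt t0)); nra. }
    apply (Rmult_le_reg_r (sqrt x)); [lra|]; field_simplify; [|lra].
    nra. }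
intros x y hxy hy hc.
eapply Rle_trans; [apply osc_above; lra|].
destruct (s10 x ltac:(lra)) as [sx ssx].
(* [x - t0] is at least [sqrt t0] and at least 1, so [x = t0 + (x - t0)] is at most twice its
   square. This gives [7/10 sqrt x <= x - t0], and [2 / (7/10) < 3]. *)
assert (d : x <= 2 * ((x - t0) * (x - t0))).
{ assert (1 <= x - t0) by nra; nra. }
assert (d' : 7 / 10 * sqrt x <= x - t0) by nra.
assert (low : 7 / 10 <= (1 - t0 / x) * sqrt x).
{ replace ((1 - t0 / x) * sqrt x) with ((x - t0) / sqrt x).
  - apply (Rmult_le_reg_r (sqrt x)); [lra|]; field_simplify; lra.
  - apply (Rmult_eq_reg_r (sqrt x)); [|lra].
    rewrite Rmult_assoc, ssx; field; lra. }
apply (Rmult_le_reg_r ((1 - t0 / x) * sqrt x)); [lra|].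
unfold Rdiv at 1; rewrite Rmult_assoc, Rinv_l by lra; lra.
Qed.

(** This serves convergence alone, so [A] may depend on [t0]: beyond [2 t0] the factor [1 - t0 / a]
    is at least 1/2, and [sqrt a >= 4 / eps] does the rest. *)
Lemma RInt_osc_small (N t0 al eps : R) :
  1 <= N -> 0 < t0 -> 0 < eps ->
  exists A, 0 < A /\
    forall a b, A <= a <= b -> Rabs (RInt (osc N t0 al) a b) <= eps.
Proof.
intros N1 t00 e0; exists (2 * t0 + (4 / eps) * (4 / eps)).
assert (p : 0 < 4 / eps) by (apply Rdiv_lt_0_compat; lra).
split; [nra|]; intros a b hab.
eapply Rle_trans; [apply osc_above; nra|].
assert (sa : 4 / eps <= sqrt a).
{ rewrite <- (sqrt_square (4 / eps)) by lra; apply sqrt_le_1_alt; lra. }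
assert (ha : / 2 <= 1 - t0 / a).
{ apply (Rmult_le_reg_r a); [nra|]; field_simplify; nra. }
apply Rle_trans with (2 / (/ 2 * (4 / eps))).
- unfold Rdiv at 1 3; apply Rmult_le_compat_l; [lra|].
  apply Rinv_le_contravar; [lra|]; apply Rmult_le_compat; lra.
- right; field; lra.
Qed.

(** * The improper integral over a half-line *)

Lemma Rabs_RInt_le_primitive (g K k : R -> R) (a b : R) :
  0 < a <= b -> (forall t, 0 < t -> continuous g t) ->
  (forall t, a <= t <= b -> is_derive K t (k t)) ->
  (forall t, a <= t <= b -> Rabs (g t) <= k t) ->
  Rabs (RInt g a b) <= K b - K a.
Proof.
intros hab cg dK gk.
assert (z : RInt g a a = 0) by apply (RInt_point a g).
replace (RInt g a b) with (RInt g a b - RInt g a a) by lra.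
apply (Rabs_incr_le_derive (fun t => RInt g a t) K g k); [lra| |exact dK|exact gk].
intros t ht; apply (is_derive_RInt g (fun t => RInt g a t) a); [|apply cg; lra].
assert (e0 : 0 < t / 2) by lra; exists (mkposreal _ e0); intros y hy.
assert (hy' : Rabs (y - t) < t / 2) by exact hy; apply Rabs_def2 in hy'.
apply (RInt_correct (V := R_CompleteNormedModule)).
apply (ex_RInt_continuous (V := R_CompleteNormedModule)); intros x hx.
apply cg; destruct (Rle_dec a y).
- rewrite Rmin_left in hx by lra; lra.
- rewrite Rmin_right in hx by lra; lra.
Qed.

Lemma filterlim_le_bound (F : R -> R) (l M T0 : R) :
  filterlim F (Rbar_locally p_infty) (locally l) ->
  (forall T, T0 <= T -> Rabs (F T) <= M) -> Rabs l <= M.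
Proof.
intros hl hM.
assert (hl' : filterlim (fun T => Rabs (F T)) (Rbar_locally p_infty) (locally (Rabs l))).
{ apply (filterlim_comp _ _ _ F Rabs _ (locally l)); [exact hl|].
  apply (continuous_Rabs l). }
apply (filterlim_le (F := Rbar_locally p_infty) (fun T => Rabs (F T)) (fun _ => M)
         (Finite (Rabs l)) (Finite M)).
- exists T0; intros T hT; apply hM; lra.
- exact hl'.
- apply filterlim_const.
Qed.

(** The constant collects [B] from [[0, 1]], [10 N B - 2 B] from [[1, T0]] with [sqrt T0 = 5 N], at
    most [13 B] from the main term beyond [T0], and [40 N^2 B / (5 N) = 8 N B] from the error
    term. *)
Lemma improper_osc (h : R -> R) (B A N t0 al : R) :
  2 <= N -> 0 < t0 -> 0 <= A <= B ->
  (forall t, continuous h t) ->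
  (forall t, 0 <= t <= 1 -> Rabs (h t) <= B) ->
  (forall t, 1 <= t -> Rabs (h t) <= B * / sqrt t) ->
  (forall t, 25 * N ^ 2 <= t ->
     Rabs (h t - A * osc N t0 al t) <= 20 * N ^ 2 * B * / (t * sqrt t)) ->
  exists I : R,
    filterlim (fun T => RInt h 0 T) (Rbar_locally p_infty) (locally I) /\
    Rabs I <= B * (18 * N + 13).
Proof.
intros N2 t00 AB ch h01 h1 hinf.
set (T0 := 25 * N ^ 2) in *.
assert (T100 : 100 <= T0) by (unfold T0; nra).
assert (sT0 : sqrt T0 = 5 * N).
{ unfold T0; replace (25 * N ^ 2) with ((5 * N) * (5 * N)) by ring.
  apply sqrt_square; lra. }
assert (eh : forall a b, ex_RInt h a b).
{ intros a b; apply (ex_RInt_continuous (V := R_CompleteNormedModule)); auto. }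
set (g := fun t => h t - A * osc N t0 al t).
assert (cg : forall t, 0 < t -> continuous g t).
{ intros t ht; apply (continuous_minus h (fun t => A * osc N t0 al t)); [apply ch|].
  apply (continuous_scal_r A (osc N t0 al)); now apply continuous_osc. }
assert (tail : forall a b, T0 <= a <= b ->
  Rabs (RInt h a b) <= B * Rabs (RInt (osc N t0 al) a b) + 40 * N ^ 2 * B / sqrt a).
{ intros a b hab.
  assert (eo := ex_RInt_osc N t0 al a b ltac:(lra)).
  assert (e : RInt h a b = RInt g a b + A * RInt (osc N t0 al) a b).
  { assert (eA : ex_RInt (fun t => A * osc N t0 al t) a b)
      by now apply (ex_RInt_scal (V := R_NormedModule)).
    assert (e1 : RInt g a b = RInt h a b - RInt (fun t => A * osc N t0 al t) a b)
      by now apply (RInt_minus (V := R_CompleteNormedModule)).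
    assert (e2 : RInt (fun t => A * osc N t0 al t) a b = A * RInt (osc N t0 al) a b)
      by now apply (RInt_scal (V := R_CompleteNormedModule)).
    lra. }
  assert (hg : Rabs (RInt g a b) <= - (40 * N ^ 2 * B) / sqrt b - - (40 * N ^ 2 * B) / sqrt a).
  { apply (Rabs_RInt_le_primitive g (fun t => - (40 * N ^ 2 * B) / sqrt t)
             (fun t => 20 * N ^ 2 * B * / (t * sqrt t))); [lra|exact cg| |].
    - intros t ht; assert (s := sqrt_lt_R0 t ltac:(lra)).
      assert (ss := sqrt_sqrt t ltac:(lra)).
      auto_derive; [repeat split; lra|].
      rewrite ss; field; lra.
    - intros t ht; apply hinf; lra. }
  assert (p : 0 <= 40 * N ^ 2 * B / sqrt b).
  { apply Rdiv_le_0_compat; [nra|]; apply sqrt_lt_R0; lra. }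
  rewrite e; eapply Rle_trans; [apply Rabs_triang|].
  rewrite Rabs_mult, (Rabs_pos_eq A) by lra.
  assert (q := Rabs_pos (RInt (osc N t0 al) a b)).
  unfold Rdiv in *; nra. }
assert (lim : exists I : R,
    filterlim (fun T => RInt h 0 T) (Rbar_locally p_infty) (locally I)).
{ apply (filterlim_locally_cauchy (U := R_CompleteSpace)).
  intros eps; assert (e0 := cond_pos eps).
  (* The divisor is [B + 1] because [B = 0] is allowed. *)
  assert (eB : 0 < eps / 4 / (B + 1)) by (apply Rdiv_lt_0_compat; lra).
  destruct (RInt_osc_small N t0 al _ ltac:(lra) t00 eB) as [A1 [A10 hA1]].
  set (q := 160 * N ^ 2 * (B + 1) / eps).
  assert (q0 : 0 < q) by (apply Rdiv_lt_0_compat; nra).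
  set (M := T0 + A1 + q * q).
  assert (small : forall a b, M <= a <= b -> Rabs (RInt h a b) < eps).
  { intros a b hab; assert (Mp : M >= T0 /\ M >= A1 /\ M >= q * q) by (unfold M; nra).
    eapply Rle_lt_trans; [apply tail; lra|].
    assert (o := hA1 a b ltac:(lra)).
    assert (sa : q <= sqrt a).
    { rewrite <- (sqrt_square q) by lra; apply sqrt_le_1_alt; lra. }
    assert (b1 : B * Rabs (RInt (osc N t0 al) a b) <= eps / 4).
    { apply Rle_trans with (B * (eps / 4 / (B + 1))).
      - apply Rmult_le_compat_l; lra.
      - replace (B * (eps / 4 / (B + 1))) with (eps / 4 * (B / (B + 1))) by (field; lra).
        rewrite <- (Rmult_1_r (eps / 4)) at 2; apply Rmult_le_compat_l; [lra|].
        apply (Rmult_le_reg_r (B + 1)); [lra|]; field_simplify; lra. }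
    assert (b2 : 40 * N ^ 2 * B / sqrt a <= eps / 4).
    { apply (Rmult_le_reg_r (sqrt a)); [lra|].
      unfold Rdiv at 1; rewrite Rmult_assoc, Rinv_l by lra.
      apply Rle_trans with (eps / 4 * q); [|apply Rmult_le_compat_l; lra].
      unfold q; replace (eps / 4 * (160 * N ^ 2 * (B + 1) / eps))
        with (40 * N ^ 2 * (B + 1)) by (field; lra); nra. }
    lra. }
  exists (fun T => M < T); split; [now exists M|].
  intros u v hu hv; change (Rabs (RInt h 0 v - RInt h 0 u) < eps).
  assert (ch0 : forall x y : R, RInt h 0 y - RInt h 0 x = RInt h x y).
  { intros x y; rewrite <- (RInt_Chasles h 0 x y) by apply eh.
    unfold plus; simpl; lra. }
  destruct (Rle_dec u v).
  - rewrite ch0; apply small; lra.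
  - rewrite Rabs_minus_sym, ch0; apply small; lra. }
destruct lim as [I hI]; exists I; split; [exact hI|].
apply (filterlim_le_bound (fun T => RInt h 0 T) I _ T0 hI).
intros T hT.
rewrite <- (RInt_Chasles h 0 1 T), <- (RInt_Chasles h 1 T0 T) by apply eh.
assert (i1 : Rabs (RInt h 0 1) <= (1 - 0) * B).
{ apply abs_RInt_le_const; [lra|apply eh|exact h01]. }
assert (i2 : Rabs (RInt h 1 T0) <= 2 * B * sqrt T0 - 2 * B * sqrt 1).
{ apply (Rabs_RInt_le_primitive h (fun t => 2 * B * sqrt t) (fun t => B * / sqrt t));
    [lra|auto| |].
  - intros t ht; assert (s := sqrt_lt_R0 t ltac:(lra)); auto_derive; [lra|field; lra].
  - intros t ht; apply h1; lra. }
rewrite sqrt_1, sT0 in i2.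
assert (i3 := tail T0 T ltac:(lra)).
assert (o := Rabs_RInt_osc_le N t0 al T0 T ltac:(lra) t00 ltac:(lra)).
rewrite sT0 in i3; replace (40 * N ^ 2 * B / (5 * N)) with (8 * N * B) in i3 by (field; lra).
eapply Rle_trans; [apply Rabs_triang|].
eapply Rle_trans; [apply Rplus_le_compat_l, Rabs_triang|].
nra.
Qed.

(** * Complex logarithm and the Stirling correction *)

Lemma C_ext (a b : C) : fst a = fst b -> snd a = snd b -> a = b.
Proof. destruct a, b; simpl; intros -> ->; reflexivity. Qed.

Lemma cexp_add (a b : C) : cexp (a + b)%C = (cexp a * cexp b)%C.
Proof.
apply C_ext; destruct a, b; unfold cexp; simpl;
  rewrite exp_plus, ?cos_plus, ?sin_plus; ring.
Qed.

Lemma cexp_0 : cexp (RtoC 0) = (RtoC 1).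
Proof.
apply C_ext; unfold cexp; simpl; rewrite exp_0, ?cos_0, ?sin_0; ring.
Qed.

Lemma Cmod_cexp (a : C) : Cmod (cexp a) = exp (Re a).
Proof.
unfold cexp, Cmod; cbn [fst snd].
replace (_ + _) with (exp (Re a) * exp (Re a) * (Rsqr (sin (Im a)) + Rsqr (cos (Im a))))
  by (unfold Rsqr; ring).
rewrite sin2_cos2, Rmult_1_r; apply sqrt_square, Rlt_le, exp_pos.
Qed.

Lemma cexp_neq0 (a : C) : cexp a <> (RtoC 0).
Proof.
apply Cmod_gt_0; rewrite Cmod_cexp; apply exp_pos.
Qed.

Lemma cexp_opp (a : C) : cexp (- a)%C = (/ cexp a)%C.
Proof.
assert (h := cexp_neq0 a).
replace (cexp (- a)) with (cexp (- a) * cexp a * / cexp a)%C by (field; exact h).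
rewrite <- cexp_add; replace (- a + a)%C with (RtoC 0) by ring.
rewrite cexp_0; field; exact h.
Qed.

Lemma cexp_pow (a : C) (n : nat) : (cexp a ^ n)%C = cexp (RtoC (INR n) * a)%C.
Proof.
induction n as [|n IH].
- simpl; replace (RtoC 0 * a)%C with (RtoC 0) by ring; now rewrite cexp_0.
- rewrite S_INR, RtoC_plus, Cmult_plus_distr_r, Cmult_1_l, cexp_add, <- IH.
  simpl; ring.
Qed.

(** The principal logarithm in the right half-plane, the only region where it is applied. *)
Definition clog (z : C) : C := (ln (Re z ^ 2 + Im z ^ 2) / 2, atan (Im z / Re z)).

Lemma cexp_clog (z : C) : 0 < Re z -> cexp (clog z) = z.
Proof.
destruct z as [x y]; unfold cexp, clog; simpl; intros x0.
assert (D0 : 0 < x * (x * 1) + y * (y * 1)) by nra.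
assert (e : exp (ln (x * (x * 1) + y * (y * 1)) / 2) = x * sqrt (1 + (y / x)²)).
{ assert (h : exp (ln (x * (x * 1) + y * (y * 1)) / 2)
              * exp (ln (x * (x * 1) + y * (y * 1)) / 2) = x * (x * 1) + y * (y * 1)).
  { rewrite <- exp_plus; transitivity (exp (ln (x * (x * 1) + y * (y * 1)))).
    - f_equal; field.
    - now apply exp_ln. }
  apply Rsqr_inj.
  - apply Rlt_le, exp_pos.
  - apply Rmult_le_pos; [lra|apply sqrt_pos].
  - unfold Rsqr at 1; rewrite h, Rsqr_mult, Rsqr_sqrt.
    + unfold Rsqr; field; lra.
    + assert (q := Rle_0_sqr (y / x)); lra. }
assert (s0 : 0 < sqrt (1 + (y / x)²)).
{ apply sqrt_lt_R0; assert (q := Rle_0_sqr (y / x)); lra. }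
rewrite e, cos_atan, sin_atan.
apply C_ext; simpl; field; lra.
Qed.

Definition lam (z : C) : C := ((z - RtoC (1 / 2)) * clog z - z)%C.

(** The defect of [lam] in the relation [L (z + 1) = L z + log z] satisfied by [log Gamma]. *)
Definition del (z : C) : C :=
  ((z + RtoC (1 / 2)) * (clog (z + RtoC 1) - clog z) - RtoC 1)%C.

Lemma lam_shift (z : C) : lam (z + RtoC 1)%C = (lam z + clog z + del z)%C.
Proof.
unfold lam, del; generalize (clog (z + RtoC 1)) (clog z); intros l' l.
apply C_ext; simpl; field.
Qed.

(* [F u = (z + u/2) (clog (z + u) - clog z) - u] satisfies [F 0 = F' 0 = 0]
   and [F'' u = (u/2) / (z + u)^2], while [F 1 = del z]. *)
Lemma del_bound (x y : R) : 0 < x ->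
  Rabs (Re (del (x, y))) <= / (12 * (x ^ 2 + y ^ 2)) /\
  Rabs (Im (del (x, y))) <= / (12 * (x ^ 2 + y ^ 2)).
Proof.
intros x0.
set (M := x ^ 2 + y ^ 2); assert (M0 : 0 < M) by (unfold M; nra).
set (D := fun u : R => (x + u) ^ 2 + y ^ 2).
assert (D0 : forall u, 0 <= u -> M <= D u) by (intros u hu; unfold M, D; nra).
set (a := fun u => ln (D u) / 2 - ln M / 2).
set (b := fun u => atan (y / (x + u)) - atan (y / x)).
assert (da : forall u, 0 <= u -> is_derive a u ((x + u) / D u)).
{ intros u hu; assert (d := D0 u hu); unfold a, D in *; auto_derive; [lra|].
  field; lra. }
assert (db : forall u, 0 <= u -> is_derive b u (- y / D u)).
{ intros u hu; assert (d := D0 u hu); unfold b, D in *; auto_derive; [lra|].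
  unfold Rsqr; field; repeat split; try lra; nra. }
set (FR := fun u => (x + u / 2) * a u - y * b u - u).
set (FI := fun u => (x + u / 2) * b u + y * a u).
set (FR' := fun u => a u / 2 - u / 2 * ((x + u) / D u)).
set (FI' := fun u => b u / 2 - u / 2 * (- y / D u)).
assert (dFR : forall u, 0 <= u -> is_derive FR u (FR' u)).
{ intros u hu; assert (d := D0 u hu); unfold FR; auto_derive.
  - repeat split; trivial; [now exists ((x + u) / D u); apply da|
                            now exists (- y / D u); apply db].
  - replace (Derive (fun x1 => a x1) u) with ((x + u) / D u)
      by (symmetry; now apply is_derive_unique, da).
    replace (Derive (fun x1 => b x1) u) with (- y / D u)
      by (symmetry; now apply is_derive_unique, db).
    unfold FR', D in *; field; lra. }
assert (dFI : forall u, 0 <= u -> is_derive FI u (FI' u)).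
{ intros u hu; assert (d := D0 u hu); unfold FI; auto_derive.
  - repeat split; trivial; [now exists (- y / D u); apply db|
                            now exists ((x + u) / D u); apply da].
  - replace (Derive (fun x1 => a x1) u) with ((x + u) / D u)
      by (symmetry; now apply is_derive_unique, da).
    replace (Derive (fun x1 => b x1) u) with (- y / D u)
      by (symmetry; now apply is_derive_unique, db).
    unfold FI', D in *; field; lra. }
assert (dFR' : forall u, 0 <= u ->
   is_derive FR' u (- (u / 2) * ((y ^ 2 - (x + u) ^ 2) / (D u) ^ 2))).
{ intros u hu; assert (d := D0 u hu); unfold FR'.
  unfold D at 1; auto_derive.
  - repeat split; trivial; [now exists ((x + u) / D u); apply da|].
    unfold D in d; nra.
  - replace (Derive (fun x1 => a x1) u) with ((x + u) / D u)
      by (symmetry; now apply is_derive_unique, da).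
    unfold D in *; field; lra. }
assert (dFI' : forall u, 0 <= u ->
   is_derive FI' u (- (u / 2) * (2 * y * (x + u) / (D u) ^ 2))).
{ intros u hu; assert (d := D0 u hu); unfold FI'.
  unfold D at 1; auto_derive.
  - repeat split; trivial; [now exists (- y / D u); apply db|].
    unfold D in d; nra.
  - replace (Derive (fun x1 => b x1) u) with (- y / D u)
      by (symmetry; now apply is_derive_unique, db).
    unfold D in *; field; lra. }
(* Both coordinates at once: up to sign, [n] is the real or imaginary part of [(z + u)^2], so
   [|n| <= D]. Two integrations from 0 turn [|F''| <= u / (2 M)] into [u^2 / (4 M)] and then
   [u^3 / (12 M)]. *)
assert (conclude : forall (F F' : R -> R) (n : R -> R),
   F 0 = 0 -> F' 0 = 0 ->
   (forall u, 0 <= u -> is_derive F u (F' u)) ->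
   (forall u, 0 <= u -> is_derive F' u (- (u / 2) * (n u / (D u) ^ 2))) ->
   (forall u, 0 <= u -> Rabs (n u) <= D u) -> Rabs (F 1) <= / (12 * M)).
{ intros F F' n F0 F0' d1 d2 hn.
  assert (b1 : forall t, 0 <= t <= 1 -> Rabs (F' t) <= t ^ 2 / (4 * M)).
  { intros t ht; replace (F' t) with (F' t - F' 0) by lra.
    replace (t ^ 2 / (4 * M)) with (t ^ 2 / (4 * M) - 0 ^ 2 / (4 * M)) by (field; lra).
    apply (Rabs_incr_le_derive F' (fun t => t ^ 2 / (4 * M))
             (fun u => - (u / 2) * (n u / (D u) ^ 2)) (fun u => u / (2 * M)));
      [lra| | |].
    - intros u hu; apply d2; lra.
    - intros u hu; auto_derive; [trivial|field; lra].
    - intros u hu; assert (d := D0 u ltac:(lra)); assert (hn' := hn u ltac:(lra)).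
      rewrite Rabs_mult, Rabs_Ropp, Rabs_pos_eq by lra.
      replace (u / (2 * M)) with (u / 2 * / M) by (field; lra).
      apply Rmult_le_compat_l; [lra|].
      unfold Rdiv; rewrite Rabs_mult, (Rabs_pos_eq (/ _)).
      2: apply Rlt_le, Rinv_0_lt_compat; nra.
      apply Rle_trans with (D u * / (D u) ^ 2).
      + apply Rmult_le_compat_r; [|exact hn'].
        apply Rlt_le, Rinv_0_lt_compat; nra.
      + replace (D u * / (D u) ^ 2) with (/ D u) by (field; lra).
        now apply Rinv_le_contravar. }
  replace (F 1) with (F 1 - F 0) by lra.
  replace (/ (12 * M)) with (1 ^ 3 / (12 * M) - 0 ^ 3 / (12 * M)) by (field; lra).
  apply (Rabs_incr_le_derive F (fun t => t ^ 3 / (12 * M)) F' (fun u => u ^ 2 / (4 * M)));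
    [lra| | |].
  - intros u hu; apply d1; lra.
  - intros u hu; auto_derive; [trivial|field; lra].
  - exact b1. }
assert (a0 : a 0 = 0) by (unfold a, D, M; rewrite Rplus_0_r; ring).
assert (b0 : b 0 = 0) by (unfold b; rewrite Rplus_0_r; ring).
split.
- replace (Re (del (x, y))) with (FR 1).
  + apply (conclude FR FR' (fun u => y ^ 2 - (x + u) ^ 2)); trivial.
    * unfold FR; rewrite a0, b0; ring.
    * unfold FR'; rewrite a0; unfold Rdiv; ring.
    * intros u hu; unfold D; apply Rabs_le; split; nra.
  + unfold FR, del, clog, a, b, D, M; simpl; unfold Rdiv; rewrite ?Rplus_0_r; ring.
- replace (Im (del (x, y))) with (FI 1).
  + apply (conclude FI FI' (fun u => 2 * y * (x + u))); trivial.
    * unfold FI; rewrite a0, b0; ring.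
    * unfold FI'; rewrite b0; unfold Rdiv; ring.
    * intros u hu; assert (p := pow2_ge_0 (x + u + y)); assert (m := pow2_ge_0 (x + u - y)).
      unfold D; apply Rabs_le; lra.
  + unfold FI, del, clog, a, b, D, M; simpl; unfold Rdiv; rewrite ?Rplus_0_r; ring.
Qed.

(** * Complex limits and the series of Stirling corrections *)

(** Coordinatewise, to match [Gamma], which is defined by two real [Lim_seq]. *)
Definition clim (u : nat -> C) (l : C) : Prop :=
  is_lim_seq (fun k => Re (u k)) (Re l) /\ is_lim_seq (fun k => Im (u k)) (Im l).

Lemma clim_ext (u v : nat -> C) (l : C) :
  (forall k, u k = v k) -> clim u l -> clim v l.
Proof.
intros e [hr hi]; split.
- apply (is_lim_seq_ext (fun k => Re (u k))); [intros k; now rewrite e|exact hr].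
- apply (is_lim_seq_ext (fun k => Im (u k))); [intros k; now rewrite e|exact hi].
Qed.

Lemma clim_const (c : C) : clim (fun _ => c) c.
Proof. split; apply is_lim_seq_const. Qed.

Lemma clim_plus (u v : nat -> C) (a b : C) :
  clim u a -> clim v b -> clim (fun k => u k + v k)%C (a + b)%C.
Proof.
intros [ur ui] [vr vi]; split.
- now apply (is_lim_seq_plus' (fun k => Re (u k)) (fun k => Re (v k))).
- now apply (is_lim_seq_plus' (fun k => Im (u k)) (fun k => Im (v k))).
Qed.

Lemma clim_mult (u v : nat -> C) (a b : C) :
  clim u a -> clim v b -> clim (fun k => u k * v k)%C (a * b)%C.
Proof.
intros [ur ui] [vr vi]; split; simpl.
- apply (is_lim_seq_minus' (fun k => Re (u k) * Re (v k)) (fun k => Im (u k) * Im (v k)));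
  now apply is_lim_seq_mult'.
- apply (is_lim_seq_plus' (fun k => Re (u k) * Im (v k)) (fun k => Im (u k) * Re (v k)));
  now apply is_lim_seq_mult'.
Qed.

Lemma clim_cexp (u : nat -> C) (a : C) :
  clim u a -> clim (fun k => cexp (u k)) (cexp a).
Proof.
intros [ur ui]; split; unfold cexp; simpl; apply is_lim_seq_mult'.
- apply (is_lim_seq_continuous exp); [apply derivable_continuous, derivable_exp|exact ur].
- apply (is_lim_seq_continuous cos); [apply continuity_cos|exact ui].
- apply (is_lim_seq_continuous exp); [apply derivable_continuous, derivable_exp|exact ur].
- apply (is_lim_seq_continuous sin); [apply continuity_sin|exact ui].
Qed.

Lemma clim_incr (u : nat -> C) (l : C) : clim (fun k => u (S k)) l <-> clim u l.
Proof.
split; intros [hr hi]; split;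
  (apply (is_lim_seq_incr_1 (fun k => Re (u k))) ||
   apply (is_lim_seq_incr_1 (fun k => Im (u k)))); assumption.
Qed.

Lemma lim_inv_S : is_lim_seq (fun k => / INR (S k)) 0.
Proof.
apply (is_lim_seq_incr_1 (fun k => / INR k)).
replace (Finite 0) with (Rbar_inv p_infty) by reflexivity.
apply is_lim_seq_inv; [apply is_lim_seq_INR|discriminate].
Qed.

(** A null majorant of the tails gives convergence by Cauchy's criterion and also a rate. The limit
    is named through [Lim_seq] because [Dl] is. *)
Lemma Lim_seq_of_tail (S v : nat -> R) :
  (forall m k, (m <= k)%nat -> Rabs (S k - S m) <= v m) -> is_lim_seq v 0 ->
  is_lim_seq S (real (Lim_seq S)) /\
  forall m, Rabs (real (Lim_seq S) - S m) <= v m.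
Proof.
intros hS hv.
assert (ex : ex_finite_lim_seq S).
{ apply ex_lim_seq_cauchy_corr; intros eps.
  assert (e2 : 0 < eps / 2) by (assert (e := cond_pos eps); lra).
  apply is_lim_seq_spec in hv; destruct (hv (mkposreal _ e2)) as [M hM].
  simpl in hM; exists M; intros n m hn hm.
  assert (h := hM M (le_n _)); rewrite Rminus_0_r in h; apply Rabs_def2 in h.
  assert (hn' := hS M n hn); assert (hm' := hS M m hm).
  replace (S n - S m) with ((S n - S M) - (S m - S M)) by ring.
  revert hn' hm'; unfold Rabs; repeat destruct Rcase_abs; lra. }
destruct ex as [l hl]; rewrite (is_lim_seq_unique _ _ hl); simpl.
split; [exact hl|]; intros m.
apply (is_lim_seq_le_loc (fun k => Rabs (S k - S m)) (fun _ => v m)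
         (Rabs (l - S m)) (v m)).
- exists m; intros k hk; now apply hS.
- apply (is_lim_seq_abs (fun k => S k - S m) (l - S m)).
  apply is_lim_seq_minus'; [exact hl|apply is_lim_seq_const].
- apply is_lim_seq_const.
Qed.

Fixpoint del_sum (z : C) (m : nat) : C :=
  match m with
  | O => RtoC 0
  | S j => (del_sum z j + del (z + RtoC (INR j)))%C
  end.

(** The sum of [del (z + j)] over [j >= 0], which is Binet's function
    [log Gamma z - lam z - log (2 pi) / 2]. *)
Definition Dl (z : C) : C :=
  (real (Lim_seq (fun m => Re (del_sum z m))), real (Lim_seq (fun m => Im (del_sum z m)))).

(** Forced by [Gamma 1 = 1], as [lam 1 = -1]. *)
Definition stirling_const : C := (RtoC 1 - Dl (RtoC 1))%C.

Lemma del_shift_bound (x y : R) (j : nat) (V : R) : 0 < x ->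
  / ((x + INR j) ^ 2 + y ^ 2) <= 12 * V ->
  Rabs (Re (del ((x, y) + RtoC (INR j))%C)) <= V /\
  Rabs (Im (del ((x, y) + RtoC (INR j))%C)) <= V.
Proof.
intros x0 hV.
replace ((x, y) + RtoC (INR j))%C with (x + INR j, y)
  by (apply C_ext; simpl; ring).
assert (j0 := pos_INR j).
destruct (del_bound (x + INR j) y ltac:(lra)) as [hr hi].
rewrite Rinv_mult in hr, hi; split; lra.
Qed.

(** Each coordinate of [del (z + j)] is at most [v j - v (j + 1)], and these bounds telescope. The
    majorant [v] stays open because two are used: one independent of [y], for convergence and
    continuity, and one decaying in [y], for the asymptotics. *)
Lemma del_sum_telescope (x y : R) (v : nat -> R) :
  0 < x ->
  (forall j, / ((x + INR j) ^ 2 + y ^ 2) <= 12 * (v j - v (S j))) ->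
  forall m k, (m <= k)%nat ->
  Rabs (Re (del_sum (x, y) k) - Re (del_sum (x, y) m)) <= v m - v k /\
  Rabs (Im (del_sum (x, y) k) - Im (del_sum (x, y) m)) <= v m - v k.
Proof.
intros x0 hv m k mk; induction mk as [|k mk [IHr IHi]].
- rewrite !Rminus_diag, Rabs_R0; lra.
- destruct (del_shift_bound x y k _ x0 (hv k)) as [hr hi].
  set (d := del _) in *; simpl del_sum; change (del _) with d.
  revert IHr IHi hr hi; destruct d as [dr di], (del_sum (x, y) k) as [sr si]; simpl.
  unfold Rabs; repeat destruct Rcase_abs; lra.
Qed.

Lemma del_sum_tail (x y : R) : 1 <= x -> forall m k, (m <= k)%nat ->
  Rabs (Re (del_sum (x, y) k) - Re (del_sum (x, y) m)) <= / 6 * / INR (S m) /\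
  Rabs (Im (del_sum (x, y) k) - Im (del_sum (x, y) m)) <= / 6 * / INR (S m).
Proof.
intros x1 m k mk.
assert (p : 0 < / INR (S k)) by (apply Rinv_0_lt_compat, lt_0_INR; lia).
destruct (del_sum_telescope x y (fun j => / 6 * / INR (S j)) ltac:(lra)) with (2 := mk)
  as [hr hi]; [|lra].
intros j; assert (j0 := pos_INR j); rewrite !S_INR.
replace (12 * _) with (2 / ((INR j + 1) * (INR j + 1 + 1))) by (field; lra).
apply Rle_trans with (/ ((INR j + 1) ^ 2)).
- apply Rinv_le_contravar; nra.
- apply (Rmult_le_reg_r ((INR j + 1) ^ 2 * (INR j + 1 + 1))); [nra|].
  field_simplify; nra.
Qed.

Lemma Dl_lim (x y : R) : 1 <= x ->
  clim (del_sum (x, y)) (Dl (x, y)) /\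
  forall m, Rabs (Re (Dl (x, y)) - Re (del_sum (x, y) m)) <= / 6 * / INR (S m) /\
            Rabs (Im (Dl (x, y)) - Im (del_sum (x, y) m)) <= / 6 * / INR (S m).
Proof.
intros x1.
assert (v0 : is_lim_seq (fun m => / 6 * / INR (S m)) 0).
{ replace (Finite 0) with (Rbar_mult (/ 6) 0) by (simpl; f_equal; ring).
  apply is_lim_seq_scal_l, lim_inv_S. }
destruct (Lim_seq_of_tail (fun m => Re (del_sum (x, y) m)) (fun m => / 6 * / INR (S m)))
  as [lr tr]; [intros m k mk; now apply del_sum_tail|exact v0|].
destruct (Lim_seq_of_tail (fun m => Im (del_sum (x, y) m)) (fun m => / 6 * / INR (S m)))
  as [li ti]; [intros m k mk; now apply del_sum_tail|exact v0|].
split; [split; assumption|]; intros m; split; [apply tr|apply ti].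
Qed.

Lemma Dl_le (x y : R) : 1 <= x -> Rabs (Re (Dl (x, y))) <= / 6.
Proof.
intros x1; destruct (Dl_lim x y x1) as [_ h]; destruct (h 0%nat) as [hr _].
revert hr; simpl; rewrite Rminus_0_r, Rinv_1; lra.
Qed.

(** With [X = x + j], the majorant [1 / (6 (X - 1 + y))] works because [(X + y)^2 <= 2 (X^2 + y^2)],
    and at [j = 0] it is at most [1 / (6 y)]. *)
Lemma Dl_le_inv (x y : R) : 1 <= x -> 0 < y ->
  Rabs (Re (Dl (x, y))) <= / (6 * y) /\ Rabs (Im (Dl (x, y))) <= / (6 * y).
Proof.
intros x1 y0; destruct (Dl_lim x y x1) as [[lr li] _].
assert (b : forall k, Rabs (Re (del_sum (x, y) k)) <= / (6 * y) /\
                      Rabs (Im (del_sum (x, y) k)) <= / (6 * y)).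
{ intros k.
  destruct (del_sum_telescope x y (fun j => / (6 * (x + INR j - 1 + y))) ltac:(lra))
    with (m := 0%nat) (k := k) as [hr hi]; [|lia|].
  - intros j; assert (j0 := pos_INR j); rewrite S_INR.
    replace (12 * _) with (2 / ((x + INR j - 1 + y) * (x + INR j + y)))
      by (field; lra).
    apply Rle_trans with (2 * / ((x + INR j + y) ^ 2)).
    + assert (q := pow2_ge_0 (x + INR j - y)).
      assert (p : 0 < (x + INR j + y) ^ 2) by (apply pow_lt; lra).
      replace (2 * / (x + INR j + y) ^ 2) with (/ ((x + INR j + y) ^ 2 / 2)) by (field; lra).
      apply Rinv_le_contravar; lra.
    + apply Rmult_le_compat_l; [lra|]; apply Rinv_le_contravar; nra.
  - assert (k0 := pos_INR k).
    assert (p : 0 < / (6 * (x + INR k - 1 + y))) by (apply Rinv_0_lt_compat; lra).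
    assert (q : / (6 * (x + INR 0 - 1 + y)) <= / (6 * y)).
    { apply Rinv_le_contravar; simpl; lra. }
    change (Re (del_sum (x, y) 0)) with 0 in hr.
    change (Im (del_sum (x, y) 0)) with 0 in hi.
    rewrite Rminus_0_r in hr, hi; lra. }
split.
- apply (is_lim_seq_le (fun k => Rabs (Re (del_sum (x, y) k))) (fun _ => / (6 * y))
           (Rabs (Re (Dl (x, y)))) (/ (6 * y))).
  + intros k; apply b.
  + now apply (is_lim_seq_abs (fun k => Re (del_sum (x, y) k)) (Re (Dl (x, y)))).
  + apply is_lim_seq_const.
- apply (is_lim_seq_le (fun k => Rabs (Im (del_sum (x, y) k))) (fun _ => / (6 * y))
           (Rabs (Im (Dl (x, y)))) (/ (6 * y))).
  + intros k; apply b.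
  + now apply (is_lim_seq_abs (fun k => Im (del_sum (x, y) k)) (Im (Dl (x, y)))).
  + apply is_lim_seq_const.
Qed.

Lemma stirling_const_bound : 5 / 6 <= Re stirling_const <= 7 / 6.
Proof.
assert (h := Dl_le 1 0 ltac:(lra)); unfold stirling_const; simpl.
change (RtoC 1) with (1, 0); revert h; unfold Dl, Re; simpl.
unfold Rabs; destruct Rcase_abs; lra.
Qed.

(** * From Euler's limit to a Stirling formula for Gamma *)

(** Each factor [z + j] is [exp (lam (z + j + 1) - lam (z + j) - del (z + j))], so the product
    telescopes. *)
Lemma rising_clog (z : C) (m : nat) : 0 < Re z ->
  rising z m = cexp (lam (z + RtoC (INR m)) - lam z - del_sum z m)%C.
Proof.
intros z0; induction m as [|m IH].
- simpl; replace (z + RtoC 0)%C with z by ring.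
  replace (lam z - lam z - RtoC 0)%C with (RtoC 0) by ring; now rewrite cexp_0.
- rewrite S_INR, RtoC_plus, Cplus_assoc, lam_shift.
  change (rising z (S m)) with (rising z m * (z + RtoC (INR m)))%C; rewrite IH.
  rewrite <- (cexp_clog (z + RtoC (INR m))%C) at 2.
  + rewrite <- cexp_add; f_equal; simpl; ring.
  + simpl; assert (h := pos_INR m); unfold Re in z0; lra.
Qed.

Lemma rising_shift (z : C) (m : nat) :
  rising z (S m) = (z * rising (z + RtoC 1) m)%C.
Proof.
induction m as [|m IH]; [simpl; ring|].
change (rising z (S (S m))) with (rising z (S m) * (z + RtoC (INR (S m))))%C.
rewrite IH, S_INR, RtoC_plus; simpl; ring.
Qed.

(** Lets the factorial in Euler's limit be expanded by the same formula as the denominator. *)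
Lemma rising_1 (m : nat) : rising (RtoC 1) m = RtoC (INR (Factorial.fact m)).
Proof.
induction m as [|m IH]; [reflexivity|].
change (rising (RtoC 1) (S m)) with (rising (RtoC 1) m * (RtoC 1 + RtoC (INR m)))%C.
rewrite IH, <- RtoC_plus, <- RtoC_mult; f_equal.
change (Factorial.fact (S m)) with ((S m) * Factorial.fact m)%nat.
rewrite mult_INR, S_INR; ring.
Qed.

Lemma atan_sub_id (u : R) : Rabs (atan u - u) <= Rabs u ^ 3 / 3.
Proof.
assert (pos : forall u, 0 <= u -> Rabs (atan u - u) <= u ^ 3 / 3).
{ intros v hv.
  replace (atan v - v) with ((atan v - v) - (atan 0 - 0)) by (rewrite atan_0; lra).
  replace (v ^ 3 / 3) with (v ^ 3 / 3 - 0 ^ 3 / 3) by field.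
  apply (Rabs_incr_le_derive (fun u => atan u - u) (fun u => u ^ 3 / 3)
           (fun u => - (u ^ 2 / (1 + u ^ 2))) (fun u => u ^ 2)); [lra| | |].
  - intros t ht; assert (q := pow2_ge_0 t); auto_derive; [trivial|].
    unfold Rsqr; field; nra.
  - intros t ht; auto_derive; [trivial|field].
  - intros t ht; assert (q := pow2_ge_0 t); rewrite Rabs_Ropp, Rabs_pos_eq.
    + apply (Rmult_le_reg_r (1 + t ^ 2)); [lra|]; field_simplify; nra.
    + apply Rdiv_le_0_compat; lra. }
destruct (Rle_dec 0 u) as [h|h].
- rewrite (Rabs_pos_eq u) by exact h; now apply pos.
- rewrite (Rabs_left u) by lra.
  replace (atan u - u) with (- (atan (- u) - - u)) by (rewrite atan_opp; ring).
  rewrite Rabs_Ropp; apply pos; lra.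
Qed.

Lemma lim_of_inv_S (u : nat -> R) (l c : R) :
  (forall k, Rabs (u k - l) <= c * / INR (S k)) -> is_lim_seq u l.
Proof.
intros h; apply is_lim_seq_ext with (fun k => (u k - l) + l); [intros; ring|].
replace (Finite l) with (Finite (0 + l)) by (f_equal; ring).
apply is_lim_seq_plus'; [|apply is_lim_seq_const].
apply is_lim_seq_abs_0.
apply (is_lim_seq_le_le (fun _ => 0) _ (fun k => c * / INR (S k))).
- intros k; split; [apply Rabs_pos|apply h].
- apply is_lim_seq_const.
- replace (Finite 0) with (Rbar_mult c 0) by (simpl; f_equal; ring).
  apply is_lim_seq_scal_l, lim_inv_S.
Qed.

Lemma clog_pos (r : R) : 0 < r -> clog (RtoC r) = RtoC (ln r).
Proof.
intros r0; apply C_ext; unfold clog; simpl.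
- replace (r * (r * 1) + 0 * (0 * 1)) with (r * r) by ring.
  rewrite ln_mult by lra; field.
- unfold Rdiv; rewrite Rmult_0_l; apply atan_0.
Qed.

(** With [N = k + 1], the expression is minus [(N + z - 1/2) log (1 + z / N) - z], and
    [N log (1 + z / N)] tends to [z]. In the proof [A] and [B] are the coordinates of
    [log (1 + z / N)]. *)
Lemma lam_asymptotic (z : C) : 0 < Re z ->
  clim (fun k => lam (RtoC (INR (S k))) + z * RtoC (ln (INR (S k)))
                 - lam (RtoC (INR (S k)) + z))%C (RtoC 0).
Proof.
destruct z as [p t]; unfold Re; simpl fst; intros p0.
set (A := fun k => ln ((INR (S k) + p) ^ 2 + t ^ 2) / 2 - ln (INR (S k))).
set (B := fun k => atan (t / (INR (S k) + p))).
assert (N1 : forall k, 1 <= INR (S k)).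
{ intros k; rewrite S_INR; assert (h := pos_INR k); lra. }
assert (i1 : forall k, 0 < / INR (S k) <= 1).
{ intros k; assert (h := N1 k); split; [apply Rinv_0_lt_compat; lra|].
  rewrite <- Rinv_1; apply Rinv_le_contravar; lra. }
assert (lNA : is_lim_seq (fun k => INR (S k) * A k) p).
{ apply (lim_of_inv_S _ _ ((2 * p + p ^ 2 + t ^ 2) ^ 2 + (p ^ 2 + t ^ 2))); intros k.
  assert (h := N1 k); assert (hi := i1 k).
  set (i := / INR (S k)) in *; set (N := INR (S k)) in *.
  assert (Ni : N * i = 1) by (unfold i; field; lra).
  set (e := 2 * p * i + (p ^ 2 + t ^ 2) * i ^ 2).
  assert (e0 : 0 < e) by (unfold e; nra).
  assert (eA : A k = ln (1 + e) / 2).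
  { unfold A; fold N; replace ((N + p) ^ 2 + t ^ 2) with (N * N * (1 + e)).
    - rewrite !ln_mult by nra; field.
    - unfold e; replace (N * N * _) with (N ^ 2 + 2 * p * N * (N * i)
        + (p ^ 2 + t ^ 2) * (N * i) ^ 2) by ring.
      rewrite Ni; ring. }
  assert (up := ln_le_sub1 (1 + e) ltac:(lra)).
  assert (lo := ln_sub_ge (1 + e) 1 ltac:(lra) ltac:(lra)); rewrite ln_1 in lo.
  assert (lo' : e - e ^ 2 <= 1 - 1 / (1 + e)).
  { apply (Rmult_le_reg_r (1 + e)); [lra|]; field_simplify; nra. }
  assert (Ne : N * e = 2 * p + (p ^ 2 + t ^ 2) * i).
  { unfold e; replace (N * _) with (2 * p * (N * i) + (p ^ 2 + t ^ 2) * i * (N * i)) by ring.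
    rewrite Ni; ring. }
  assert (pt : 0 <= p ^ 2 + t ^ 2) by nra.
  assert (Ne2 : N * e ^ 2 <= (2 * p + p ^ 2 + t ^ 2) ^ 2 * i).
  { replace (N * e ^ 2) with ((N * e) ^ 2 * i).
    - rewrite Ne; apply Rmult_le_compat_r; [lra|]; apply pow_incr; nra.
    - replace ((N * e) ^ 2 * i) with (N * e ^ 2 * (N * i)) by ring; rewrite Ni; ring. }
  assert (up' : N * ln (1 + e) <= N * e) by (apply Rmult_le_compat_l; lra).
  assert (low : N * (e - e ^ 2) <= N * ln (1 + e)) by (apply Rmult_le_compat_l; lra).
  rewrite eA; apply Rabs_le; split; nra. }
assert (lNB : is_lim_seq (fun k => INR (S k) * B k) t).
{ apply (lim_of_inv_S _ _ (Rabs t ^ 3 / 3 + Rabs t * p)); intros k.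
  assert (h := N1 k); assert (hi := i1 k).
  set (N := INR (S k)) in *; set (u := t / (N + p)).
  assert (b := atan_sub_id u); unfold B; fold N; fold u.
  replace (N * atan u - t) with (N * (atan u - u) - u * p) by (unfold u; field; lra).
  assert (ua : Rabs u <= Rabs t * / N).
  { unfold u, Rdiv; rewrite Rabs_mult, (Rabs_pos_eq (/ _)).
    - apply Rmult_le_compat_l; [apply Rabs_pos|]; apply Rinv_le_contravar; lra.
    - apply Rlt_le, Rinv_0_lt_compat; lra. }
  eapply Rle_trans; [apply Rabs_triang|].
  rewrite Rabs_Ropp, !Rabs_mult, (Rabs_pos_eq N), (Rabs_pos_eq p) by lra.
  rewrite Rmult_plus_distr_r; apply Rplus_le_compat.
  - apply Rle_trans with (N * ((Rabs t * / N) ^ 3 / 3)).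
    + apply Rmult_le_compat_l; [lra|]; eapply Rle_trans; [exact b|].
      unfold Rdiv; apply Rmult_le_compat_r; [lra|].
      apply pow_incr; split; [apply Rabs_pos|exact ua].
    + replace (N * ((Rabs t * / N) ^ 3 / 3)) with (Rabs t ^ 3 / 3 * / N * / N)
        by (field; lra).
      rewrite <- (Rmult_1_r (Rabs t ^ 3 / 3 * / N)) at 2.
      apply Rmult_le_compat_l; [|lra].
      assert (q := pow_le (Rabs t) 3 (Rabs_pos t)); nra.
  - rewrite (Rmult_comm (Rabs t)), Rmult_assoc, (Rmult_comm (Rabs u)).
    apply Rmult_le_compat_l; lra. }
assert (unscale : forall u l, is_lim_seq (fun k => INR (S k) * u k) (Finite l) ->
          is_lim_seq u 0).
{ intros u l hu; apply is_lim_seq_ext with (fun k => / INR (S k) * (INR (S k) * u k)).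
  - intros k; field; assert (h := N1 k); lra.
  - replace (Finite 0) with (Finite (0 * l)) by (f_equal; ring).
    apply is_lim_seq_mult'; [apply lim_inv_S|exact hu]. }
assert (lA := unscale _ _ lNA); assert (lB := unscale _ _ lNB).
apply clim_ext with (fun k =>
  (- (INR (S k) * A k + (p - 1 / 2) * A k - t * B k - p),
   - (INR (S k) * B k + (p - 1 / 2) * B k + t * A k - t)) : C).
{ intros k; unfold lam; rewrite clog_pos by (assert (h := N1 k); lra).
  unfold clog, A, B; cbn [Re Im fst snd Cplus RtoC].
  rewrite Rplus_0_l.
  apply C_ext; cbn [Re Im fst snd Cplus Cmult Cminus Copp RtoC]; ring. }
split; unfold Re, Im; cbn [fst snd RtoC].
- replace (Finite 0) with (Rbar_opp (Finite (p + (p - 1 / 2) * 0 - t * 0 - p)))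
    by (simpl; f_equal; ring).
  apply (proj1 (is_lim_seq_opp (fun k => INR (S k) * A k + (p - 1 / 2) * A k - t * B k - p) _)).
  apply (is_lim_seq_minus' (fun k => INR (S k) * A k + (p - 1 / 2) * A k - t * B k) (fun _ => p));
    [|apply is_lim_seq_const].
  apply (is_lim_seq_minus' (fun k => INR (S k) * A k + (p - 1 / 2) * A k) (fun k => t * B k)).
  + apply is_lim_seq_plus'; [exact lNA|].
    apply (is_lim_seq_scal_l A (p - 1 / 2) 0 lA).
  + apply (is_lim_seq_scal_l B t 0 lB).
- replace (Finite 0) with (Rbar_opp (Finite (t + (p - 1 / 2) * 0 + t * 0 - t)))
    by (simpl; f_equal; ring).
  apply (proj1 (is_lim_seq_opp (fun k => INR (S k) * B k + (p - 1 / 2) * B k + t * A k - t) _)).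
  apply (is_lim_seq_minus' (fun k => INR (S k) * B k + (p - 1 / 2) * B k + t * A k) (fun _ => t));
    [|apply is_lim_seq_const].
  apply (is_lim_seq_plus' (fun k => INR (S k) * B k + (p - 1 / 2) * B k) (fun k => t * A k)).
  + apply is_lim_seq_plus'; [exact lNB|].
    apply (is_lim_seq_scal_l B (p - 1 / 2) 0 lB).
  + apply (is_lim_seq_scal_l A t 0 lA).
Qed.

Lemma clim_del_nat : clim (fun k => del (RtoC (INR (S k)))) (RtoC 0).
Proof.
assert (b : forall k, / (12 * (INR (S k) ^ 2 + 0 ^ 2)) <= 1 * / INR (S k)).
{ intros k; rewrite Rmult_1_l; rewrite S_INR; assert (h := pos_INR k).
  apply Rinv_le_contravar; nra. }
assert (p : forall k, 0 < INR (S k)) by (intros; apply lt_0_INR; lia).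
split; apply (lim_of_inv_S _ _ 1); intros k; unfold RtoC at 2; cbn [Re Im fst snd];
  rewrite Rminus_0_r; destruct (del_bound (INR (S k)) 0 (p k)) as [hr hi];
  eapply Rle_trans; [exact hr|apply b|exact hi|apply b].
Qed.

(** Two factors are split off the denominator of Euler's limit so that the expansion takes place at
    [s + 2]: for [Re s > -1] its real part exceeds 1, within the range of the bounds on [Dl]. *)
Lemma Gamma_formula (s : C) : -1 < Re s -> s <> RtoC 0 ->
  Gamma s = (cexp (lam (s + RtoC 2) + stirling_const + Dl (s + RtoC 2))
             / (s * (s + RtoC 1)))%C.
Proof.
intros s1 s0; set (z := (s + RtoC 2)%C).
assert (ez : z = (s + RtoC 1 + RtoC 1)%C).
{ unfold z; rewrite <- Cplus_assoc, <- RtoC_plus; do 2 f_equal; ring. }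
assert (z0 : 0 < Re z) by (unfold z, Re in *; simpl; lra).
assert (s10 : (s + RtoC 1)%C <> RtoC 0).
{ intros e; apply (f_equal Re) in e; unfold Re in *; simpl in e; lra. }
assert (lim : clim (gamma_seq s) (cexp (lam z + stirling_const + Dl z)
                                  / (s * (s + RtoC 1)))%C).
{ apply clim_incr.
  (* With [N = k + 1], the factorial is [rising 1 N], and [lam (N + 1) = lam N + log N + del N]. The
     extra [log N] turns [N^s] into [N^(s + 1)]; the isolated term [1] is [- lam 1]. *)
  apply clim_ext with (fun k => / (s * (s + RtoC 1)) * cexp (
     (lam (RtoC (INR (S k))) + (s + RtoC 1) * RtoC (ln (INR (S k)))
        - lam (RtoC (INR (S k)) + (s + RtoC 1)))
     + del (RtoC (INR (S k))) + RtoC 1 + RtoC (-1) * del_sum (RtoC 1) (S k)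
     + lam z + del_sum z k))%C.
  - intros k; unfold gamma_seq, rcpow.
    rewrite rising_shift, rising_shift, <- ez, rising_clog by exact z0.
    rewrite <- rising_1, rising_clog by (unfold Re; simpl; lra).
    assert (p : 0 < INR (S k)) by (apply lt_0_INR; lia).
    assert (combine : forall f q e : C,
      (cexp f * cexp q / (s * ((s + RtoC 1) * cexp e)) =
       / (s * (s + RtoC 1)) * cexp (f + q + - e))%C).
    { intros f q e; rewrite !cexp_add, cexp_opp; field.
      repeat split; trivial; apply cexp_neq0. }
    rewrite combine; do 2 f_equal.
    assert (ezk : (z + RtoC (INR k))%C = (RtoC (INR (S k)) + (s + RtoC 1))%C).
    { rewrite ez, S_INR, RtoC_plus; ring. }
    rewrite ezk, (Cplus_comm (RtoC 1) (RtoC (INR (S k)))), lam_shift, (clog_pos _ p).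
    assert (l1 : lam (RtoC 1) = RtoC (-1)).
    { unfold lam; rewrite clog_pos, ln_1 by lra; apply C_ext; simpl; ring. }
    rewrite l1.
    generalize (lam z) (del_sum z k) (del_sum (RtoC 1) (S k)) (del (RtoC (INR (S k))))
      (lam (RtoC (INR (S k)))) (lam (RtoC (INR (S k)) + (s + RtoC 1))%C) (ln (INR (S k))).
    intros; apply C_ext; simpl; ring.
  - unfold Cdiv; rewrite (Cmult_comm (cexp _) (/ _)); apply clim_mult; [apply clim_const|].
    replace (lam z + stirling_const + Dl z)%C with
      (RtoC 0 + RtoC 0 + RtoC 1 + RtoC (-1) * Dl (RtoC 1) + lam z + Dl z)%C.
    + apply clim_cexp; repeat apply clim_plus; try apply clim_const.
      * apply lam_asymptotic; unfold Re in *; simpl; lra.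
      * apply clim_del_nat.
      * apply clim_mult; [apply clim_const|]; apply clim_incr.
        apply (Dl_lim 1 0); lra.
      * unfold z, Re in *; destruct s as [x y]; simpl in *.
        apply (Dl_lim (x + 2) (y + 0)); lra.
    + unfold stirling_const; apply C_ext; simpl; ring. }
destruct lim as [hr hi]; unfold Gamma.
rewrite (is_lim_seq_unique _ _ hr), (is_lim_seq_unique _ _ hi).
symmetry; apply surjective_pairing.
Qed.

(** * Asymptotics of the integrand *)

Lemma exp_le (a b : R) : a <= b -> exp a <= exp b.
Proof. intros [h | ->]; [left; now apply exp_increasing|right; reflexivity]. Qed.

Lemma exp_sub1_le (e : R) : 0 <= e <= 1 / 2 -> exp e - 1 <= 2 * e.
Proof.
intros he; assert (h : 1 - e <= exp (- e)).
{ assert (q := exp_ineq1_le (- e)); lra. }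
rewrite exp_Ropp in h; assert (p := exp_pos e).
assert (h' : (1 - e) * exp e <= 1).
{ apply Rle_trans with (/ exp e * exp e); [apply Rmult_le_compat_r; lra|].
  rewrite Rinv_l; lra. }
nra.
Qed.

(** Relative errors are measured by exponents: with [x' = e^x - 1] and [y' = e^y - 1] one has
    [x' y' + x' + y' = e^(x + y) - 1], so the bounds for a product simply add up, whatever their
    size. The clause on the inverse lets numerators and denominators be treated alike. *)
Definition near1 (v : C) (e : R) : Prop :=
  v <> RtoC 0 /\ Cmod (v - RtoC 1)%C <= exp e - 1 /\ Cmod (/ v - RtoC 1)%C <= exp e - 1.

Lemma near1_weaken (v : C) (e e' : R) : e <= e' -> near1 v e -> near1 v e'.
Proof. intros h [v0 [h1 h2]]; assert (q := exp_le _ _ h); repeat split; trivial; lra. Qed.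

Lemma near1_inv (v : C) (e : R) : near1 v e -> near1 (/ v)%C e.
Proof.
intros [v0 [h1 h2]]; assert (iv : (/ v)%C <> RtoC 0).
{ apply Cmod_gt_0; rewrite Cmod_inv by trivial.
  now apply Rinv_0_lt_compat, Cmod_gt_0. }
repeat split; trivial.
now replace (/ / v)%C with v by (field; auto).
Qed.

Lemma Cmod_mult_sub1 (a b : C) (x y : R) :
  Cmod (a - RtoC 1)%C <= exp x - 1 -> Cmod (b - RtoC 1)%C <= exp y - 1 ->
  Cmod (a * b - RtoC 1)%C <= exp (x + y) - 1.
Proof.
intros ha hb.
replace (a * b - RtoC 1)%C with
  ((a - RtoC 1) * (b - RtoC 1) + ((a - RtoC 1) + (b - RtoC 1)))%C by ring.
eapply Rle_trans; [apply Cmod_triangle|].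
assert (t := Cmod_triangle (a - RtoC 1)%C (b - RtoC 1)%C).
rewrite Cmod_mult, exp_plus.
assert (pa := Cmod_ge_0 (a - RtoC 1)%C); assert (pb := Cmod_ge_0 (b - RtoC 1)%C).
nra.
Qed.

Lemma near1_mult (a b : C) (x y : R) :
  near1 a x -> near1 b y -> near1 (a * b)%C (x + y).
Proof.
intros [a0 [a1 a2]] [b0 [b1 b2]]; split; [|split].
- now apply Cmult_neq_0.
- now apply Cmod_mult_sub1.
- replace (/ (a * b))%C with (/ a * / b)%C by (field; auto).
  now apply Cmod_mult_sub1.
Qed.

Lemma near1_1 : near1 (RtoC 1) 0.
Proof.
split; [intros e; apply (f_equal fst) in e; simpl in e; lra|].
replace (/ RtoC 1)%C with (RtoC 1) by (field; intros e; apply (f_equal fst) in e; simpl in e; lra).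
replace (RtoC 1 - RtoC 1)%C with (RtoC 0) by ring; rewrite Cmod_0, exp_0; lra.
Qed.

Lemma near1_pow (a : C) (x : R) (n : nat) : near1 a x -> near1 (a ^ n)%C (INR n * x).
Proof.
intros h; induction n as [|n IH].
- simpl; rewrite Rmult_0_l; apply near1_1.
- rewrite S_INR, Cpow_S; replace ((INR n + 1) * x) with (x + INR n * x) by ring.
  now apply near1_mult.
Qed.

Lemma exp_sub1_Rabs (a : R) : Rabs (exp a - 1) <= exp (Rabs a) - 1.
Proof.
destruct (Rle_dec 0 a) as [h|h].
- assert (q := exp_ineq1_le a); rewrite !Rabs_pos_eq by lra; lra.
- rewrite (Rabs_left a) by lra.
  assert (q := exp_ineq1_le (- a)); assert (q' := exp_le a 0 ltac:(lra)).
  assert (q2 := exp_ineq1_le a).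
  rewrite exp_0 in q'; rewrite Rabs_left1 by lra; lra.
Qed.

(** The modulus equals [2 |sin (b / 2)|]. *)
Lemma Cmod_cis_sub1 (b : R) : Cmod (cexp (0, b) - RtoC 1)%C <= Rabs b.
Proof.
apply Rsqr_incr_0; [|apply Cmod_ge_0|apply Rabs_pos].
unfold Rsqr; replace (Cmod _ * Cmod _) with (Cmod (cexp (0, b) - RtoC 1)%C ^ 2) by ring.
rewrite Cmod2_alt; unfold cexp; simpl; rewrite exp_0.
replace (Rabs b * Rabs b) with (b * b) by (rewrite <- Rabs_mult, Rabs_pos_eq; nra).
assert (c := sin2_cos2 b); unfold Rsqr in c.
assert (h : cos b = 1 - 2 * sin (b / 2) * sin (b / 2)).
{ rewrite <- cos_2a_sin; f_equal; field. }
assert (hs : Rabs (sin (b / 2)) <= Rabs (b / 2)).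
{ assert (pos : forall u, 0 <= u -> Rabs (sin u) <= u).
  { intros u hu; destruct (Rle_dec u 1) as [u1|u1].
    - destruct (Req_dec u 0) as [->|u0]; [rewrite sin_0, Rabs_R0; lra|].
      assert (q := sin_lt_x u ltac:(lra)).
      assert (q' := sin_ge_0 u hu ltac:(assert (z := PI2_1); lra)).
      rewrite Rabs_pos_eq; lra.
    - apply Rle_trans with 1; [|lra].
      apply Rabs_le; generalize (SIN_bound u); lra. }
  destruct (Rle_dec 0 (b / 2)).
  - rewrite (Rabs_pos_eq (b / 2)) by lra; now apply pos.
  - rewrite (Rabs_left (b / 2)), <- Rabs_Ropp, <- sin_neg by lra; apply pos; lra. }
assert (sq : sin (b / 2) * sin (b / 2) <= b / 2 * (b / 2)).
{ assert (q := Rsqr_le_abs_1 _ _ hs); exact q. }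
nra.
Qed.

Lemma near1_cexp (a : C) : near1 (cexp a) (Rabs (Re a) + Rabs (Im a)).
Proof.
assert (one : forall c : C, Cmod (cexp c - RtoC 1)%C <= exp (Rabs (Re c) + Rabs (Im c)) - 1).
{ intros [x y].
  replace (cexp (x, y)) with (cexp (x, 0) * cexp (0, y))%C
    by (rewrite <- cexp_add; f_equal; apply C_ext; simpl; ring).
  apply Cmod_mult_sub1; unfold Re, Im; simpl fst; simpl snd.
  - replace (cexp (x, 0) - RtoC 1)%C with (RtoC (exp x - 1))
      by (apply C_ext; unfold cexp; simpl; rewrite ?cos_0, ?sin_0; ring).
    rewrite Cmod_R; apply exp_sub1_Rabs.
  - eapply Rle_trans; [apply Cmod_cis_sub1|].
    assert (q := exp_ineq1_le (Rabs y)); lra. }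
split; [apply cexp_neq0|split; [apply one|]].
rewrite <- cexp_opp; eapply Rle_trans; [apply one|].
right; destruct a; simpl; now rewrite !Rabs_Ropp.
Qed.

(** With [e = |v - 1|] one has [|1 / v - 1| <= e / (1 - e) <= 2 e <= exp (2 e) - 1]. *)
Lemma near1_of_small (v : C) : Cmod (v - RtoC 1)%C <= 1 / 2 ->
  near1 v (2 * Cmod (v - RtoC 1)%C).
Proof.
set (e := Cmod (v - RtoC 1)%C); intros he.
assert (e0 : 0 <= e) by apply Cmod_ge_0.
assert (q := exp_ineq1_le (2 * e)).
assert (v1 : 1 - e <= Cmod v).
{ assert (t := Cmod_triangle v (- (v - RtoC 1))%C).
  replace (v + - (v - RtoC 1))%C with (RtoC 1) in t by ring.
  rewrite Cmod_1, Cmod_opp in t; fold e in t; lra. }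
assert (v0 : v <> RtoC 0) by (apply Cmod_gt_0; lra).
split; [exact v0|split; [fold e; lra|]].
replace (/ v - RtoC 1)%C with (- ((v - RtoC 1) * / v))%C by (field; exact v0).
rewrite Cmod_opp, Cmod_mult, Cmod_inv by exact v0; fold e.
apply Rle_trans with (e * / (1 / 2)); [|field_simplify; lra].
apply Rmult_le_compat_l; [exact e0|]; apply Rinv_le_contravar; lra.
Qed.

Lemma Cmod_ge_im (x y : R) : Rabs y <= Cmod (x, y).
Proof.
eapply Rle_trans; [|apply Rmax_Cmod]; simpl; apply Rmax_r.
Qed.

(* The branch of the logarithm of [i t]. *)
Definition clogI (t : R) : C := (ln t, PI / 2).

Lemma cexp_clogI (t : R) : 0 < t -> cexp (clogI t) = (0, t).
Proof.
intros h; unfold cexp, clogI; simpl; rewrite exp_ln, cos_PI2, sin_PI2 by exact h.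
apply C_ext; simpl; ring.
Qed.

Lemma near1_ratio (a t : R) : 0 < t -> near1 ((a, t) / cexp (clogI t))%C (Rabs a / t).
Proof.
intros t0; rewrite cexp_clogI by exact t0.
assert (i0 : ((0, t) : C) <> RtoC 0).
{ intros e; apply (f_equal snd) in e; simpl in e; lra. }
assert (a0 : ((a, t) : C) <> RtoC 0).
{ intros e; apply (f_equal snd) in e; simpl in e; lra. }
assert (mi : Cmod (0, t) = t).
{ replace ((0, t) : C) with (RtoC t * Ci)%C by (apply C_ext; simpl; ring).
  rewrite Cmod_mult, Cmod_Ci, Cmod_R, Rabs_pos_eq; lra. }
assert (dif : ((a, t) - (0, t))%C = RtoC a) by (apply C_ext; simpl; ring).
assert (q := exp_ineq1_le (Rabs a / t)).
assert (ra := Rabs_pos a).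
split; [|split].
- unfold Cdiv; apply Cmult_neq_0; [exact a0|].
  apply Cmod_gt_0; rewrite Cmod_inv, mi by exact i0; now apply Rinv_0_lt_compat.
- replace ((a, t) / (0, t) - RtoC 1)%C with (((a, t) - (0, t)) / (0, t))%C
    by (field; exact i0).
  rewrite dif, Cmod_div, Cmod_R, mi by exact i0; lra.
- replace (/ ((a, t) / (0, t)) - RtoC 1)%C with (- ((a, t) - (0, t)) / (a, t))%C
    by (field; split; [exact i0|exact a0]).
  rewrite Cmod_div, Cmod_opp, dif, Cmod_R by exact a0.
  apply Rle_trans with (Rabs a / t); [|lra].
  unfold Rdiv; apply Rmult_le_compat_l; [exact ra|].
  apply Rinv_le_contravar; [exact t0|].
  assert (h := Cmod_ge_im a t); rewrite Rabs_pos_eq in h; lra.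
Qed.

(** * The trigonometric factors *)

Lemma trig_arg (sg t : R) :
  (RtoC PI * (sg, t) / RtoC 2)%C = (PI * sg / 2, PI * t / 2).
Proof. apply C_ext; simpl; field; lra. Qed.

Lemma ccos_coord (a b : R) :
  ccos (a, b) = (cos a * ((exp b + exp (- b)) / 2), - sin a * ((exp b - exp (- b)) / 2)).
Proof.
unfold ccos, cexp.
replace (Ci * (a, b))%C with ((- b)%R, a) by (apply C_ext; simpl; ring).
replace (- ((- b)%R, a))%C with (b, (- a)%R) by (apply C_ext; simpl; ring).
unfold Re, Im; simpl fst; simpl snd; rewrite cos_neg, sin_neg.
apply C_ext; simpl; field; lra.
Qed.

Lemma csin_coord (a b : R) :
  csin (a, b) = (sin a * ((exp b + exp (- b)) / 2), cos a * ((exp b - exp (- b)) / 2)).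
Proof.
unfold csin, cexp.
replace (Ci * (a, b))%C with ((- b)%R, a) by (apply C_ext; simpl; ring).
replace (- ((- b)%R, a))%C with (b, (- a)%R) by (apply C_ext; simpl; ring).
unfold Re, Im; simpl fst; simpl snd; rewrite cos_neg, sin_neg.
apply C_ext; simpl; field; lra.
Qed.

Lemma Cmod_ge_re (x y : R) : Rabs x <= Cmod (x, y).
Proof. eapply Rle_trans; [|apply Rmax_Cmod]; simpl; apply Rmax_l. Qed.

Lemma Rabs_mult_cosh_ge (u b : R) : 1 / 4 <= Rabs u ->
  exp b / 8 <= Rabs (u * ((exp b + exp (- b)) / 2)).
Proof.
intros hu; assert (p := exp_pos b); assert (q := exp_pos (- b)).
rewrite Rabs_mult, (Rabs_pos_eq ((_ + _) / 2)) by lra; nra.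
Qed.

(** The real part, [cos a] times [cosh b], is already large enough. Each trigonometric factor costs
    8, hence the [ln 8] in [log_bound]. *)
Lemma Cmod_ccos_ge (a b : R) : 1 / 4 <= Rabs (cos a) -> exp b / 8 <= Cmod (ccos (a, b)).
Proof.
intros h; rewrite ccos_coord; eapply Rle_trans; [|apply Cmod_ge_re].
now apply Rabs_mult_cosh_ge.
Qed.

Lemma Cmod_csin_ge (a b : R) : 1 / 4 <= Rabs (sin a) -> exp b / 8 <= Cmod (csin (a, b)).
Proof.
intros h; rewrite csin_coord; eapply Rle_trans; [|apply Cmod_ge_re].
now apply Rabs_mult_cosh_ge.
Qed.

(* Up to the factor [1 + exp(i pi s)], the cosine is [exp(-i pi s/2)/2]. *)
Definition trig_log (sg t : R) : C := ((PI * t / 2 - ln 2)%R, (- (PI * sg / 2))%R).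

(** For [s = sg + i t] this is [i pi s], so its exponential has modulus [exp (- pi t)]. *)
Definition nome (sg t : R) : C := ((- (PI * t))%R, (PI * sg)%R).

Lemma cexp_trig_log (sg t : R) :
  cexp (trig_log sg t) =
  (exp (PI * t / 2) / 2 * cos (PI * sg / 2), - (exp (PI * t / 2) / 2 * sin (PI * sg / 2))).
Proof.
unfold trig_log, cexp; simpl; unfold Rminus; rewrite exp_plus, exp_Ropp, exp_ln by lra.
rewrite cos_neg, sin_neg; apply C_ext; simpl; field.
Qed.

Lemma cexp_nome (sg t : R) : cexp (nome sg t) =
  (exp (- (PI * t / 2)) * exp (- (PI * t / 2))
     * (cos (PI * sg / 2) * cos (PI * sg / 2) - sin (PI * sg / 2) * sin (PI * sg / 2)),
   exp (- (PI * t / 2)) * exp (- (PI * t / 2))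
     * (2 * sin (PI * sg / 2) * cos (PI * sg / 2))).
Proof.
unfold cexp, nome; simpl; rewrite <- exp_plus, <- cos_2a, <- sin_2a.
apply C_ext; simpl; f_equal; f_equal; field.
Qed.

Lemma ccos_polar (sg t : R) :
  ccos (RtoC PI * (sg, t) / RtoC 2)%C =
  (cexp (trig_log sg t) * (RtoC 1 + cexp (nome sg t)))%C.
Proof.
rewrite trig_arg, ccos_coord, cexp_trig_log, cexp_nome.
assert (c := sin2_cos2 (PI * sg / 2)); unfold Rsqr in c.
assert (e : exp (PI * t / 2) * exp (- (PI * t / 2)) = 1)
  by (rewrite exp_Ropp; field; apply Rgt_not_eq, exp_pos).
revert c e; generalize (exp (PI * t / 2)) (exp (- (PI * t / 2)))
  (cos (PI * sg / 2)) (sin (PI * sg / 2)); intros E F c s h e.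
apply C_ext; simpl.
- replace (_ - _) with (E / 2 * c + (E * F) * F / 2 * (c * (s * s + c * c))) by field.
  rewrite e, h; field.
- replace (_ + _) with (- (E / 2 * s) + (E * F) * F / 2 * (s * (s * s + c * c))) by field.
  rewrite e, h; field.
Qed.

(** The shift by [(0, PI / 2)] is the factor [i] in [sin (pi s / 2) = (i / 2) exp (- i pi s / 2) (1
    - exp (i pi s))]. *)
Lemma csin_polar (sg t : R) :
  csin (RtoC PI * (sg, t) / RtoC 2)%C =
  (cexp (trig_log sg t + (0, PI / 2)%R) * (RtoC 1 - cexp (nome sg t)))%C.
Proof.
rewrite cexp_add.
replace (cexp (0, (PI / 2)%R)) with Ci
  by (unfold cexp; simpl; rewrite exp_0, cos_PI2, sin_PI2; apply C_ext; simpl; ring).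
rewrite trig_arg, csin_coord, cexp_trig_log, cexp_nome.
assert (c := sin2_cos2 (PI * sg / 2)); unfold Rsqr in c.
assert (e : exp (PI * t / 2) * exp (- (PI * t / 2)) = 1)
  by (rewrite exp_Ropp; field; apply Rgt_not_eq, exp_pos).
revert c e; generalize (exp (PI * t / 2)) (exp (- (PI * t / 2)))
  (cos (PI * sg / 2)) (sin (PI * sg / 2)); intros E F c s h e.
apply C_ext; simpl.
- transitivity (E / 2 * s + (E * F) * F / 2 * (s * (s * s + c * c))).
  + rewrite e, h; field.
  + field.
- transitivity (E / 2 * c - (E * F) * F / 2 * (c * (s * s + c * c))).
  + rewrite e, h; field.
  + field.
Qed.

(** The error is exponentially small, but [exp (- pi t) <= 1 / (2 t)] suffices, since the Stirling
    errors are of order [1 / t] anyway. *)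
Lemma near1_trig (sg t : R) : 1 <= t ->
  near1 (RtoC 1 + cexp (nome sg t))%C (/ t) /\
  near1 (RtoC 1 - cexp (nome sg t))%C (/ t).
Proof.
intros t1; set (eps := cexp _).
assert (m : Cmod eps <= / (2 * t)).
{ unfold eps, nome; rewrite Cmod_cexp; simpl; rewrite exp_Ropp.
  apply Rinv_le_contravar; [lra|].
  assert (q := exp_ineq1_le (PI * t)); assert (p := PI2_1).
  assert (2 * t <= PI * t) by (apply Rmult_le_compat_r; lra); lra. }
assert (h : / (2 * t) <= 1 / 2).
{ replace (1 / 2) with (/ 2) by field; apply Rinv_le_contravar; lra. }
assert (tt : / t = 2 * / (2 * t)) by (field; lra).
split.
- assert (e : (RtoC 1 + eps - RtoC 1)%C = eps) by ring.
  apply near1_weaken with (2 * Cmod (RtoC 1 + eps - RtoC 1)%C); [rewrite e; lra|].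
  apply near1_of_small; rewrite e; lra.
- assert (e : (RtoC 1 - eps - RtoC 1)%C = (- eps)%C) by ring.
  apply near1_weaken with (2 * Cmod (RtoC 1 - eps - RtoC 1)%C);
    [rewrite e, Cmod_opp; lra|].
  apply near1_of_small; rewrite e, Cmod_opp; lra.
Qed.

(** * Size of the integrand on a vertical line *)

(** The term [- z] of [lam] becomes [- i t]: to first order [log z] is [log (i t) - i x / t], and
    [i t] times this correction is [x], which cancels the real part of [- z]. *)
Definition lam_main (x t : R) : C :=
  (((x, t) - RtoC (1 / 2)) * clogI t - (0, t))%C.

Lemma near1_lam (x t : R) : 1 <= x <= 5 / 2 -> 100 <= t ->
  near1 (cexp (lam (x, t) - lam_main x t)) (9 / t).
Proof.
intros hx ht.
(* [al - i be] is [log (x + i t) - log (i t)]. The coordinates of the exponent end up below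
   [0.5 / t] and [8.2 / t], whence the 9. *)
set (al := ln (1 + (x / t) ^ 2) / 2); set (be := atan (x / t)).
assert (e : (lam (x, t) - lam_main x t)%C =
   ((x - 1 / 2) * al + t * be - x, - (x - 1 / 2) * be + t * al)).
{ assert (l : clog (x, t) = (ln t + al, PI / 2 - be)).
  { unfold clog, Re, Im; apply C_ext; cbn [fst snd].
    - unfold al; replace (x ^ 2 + t ^ 2) with (t * t * (1 + (x / t) ^ 2)) by (field; lra).
      assert (p := pow2_ge_0 (x / t)); rewrite !ln_mult by nra; field.
    - unfold be; replace (t / x) with (/ (x / t)) by (field; lra).
      apply atan_inv, Rdiv_lt_0_compat; lra. }
  unfold lam, lam_main; rewrite l; unfold clogI; apply C_ext; simpl; ring. }
eapply near1_weaken; [|apply near1_cexp]; rewrite e; simpl.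
assert (u0 : 0 < x / t <= 5 / 2 / t).
{ split; [apply Rdiv_lt_0_compat; lra|].
  unfold Rdiv at 1 2; apply Rmult_le_compat_r; [|lra].
  apply Rlt_le, Rinv_0_lt_compat; lra. }
set (i := / t) in *.
assert (i0 : 0 < i <= / 100).
{ unfold i; split; [apply Rinv_0_lt_compat; lra|apply Rinv_le_contravar; lra]. }
assert (ti : t * i = 1) by (unfold i; field; lra).
assert (xt : x / t = x * i) by reflexivity.
assert (a1 : 0 <= al <= (x * i) ^ 2 / 2).
{ unfold al; rewrite xt; assert (p := pow2_ge_0 (x * i)); split.
  - assert (q := ln_le 1 (1 + (x * i) ^ 2) ltac:(lra) ltac:(lra)); rewrite ln_1 in q; lra.
  - assert (q := ln_le_sub1 (1 + (x * i) ^ 2) ltac:(lra)); lra. }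
assert (b1 := atan_sub_id (x / t)); fold be in b1.
rewrite (Rabs_pos_eq (x / t)) in b1 by lra; rewrite xt in b1.
assert (b0 : 0 < be).
{ unfold be; rewrite <- atan_0; apply atan_increasing; lra. }
assert (b2 : be <= x * i).
{ assert (g := Rabs_incr_le_derive atan (fun u => u) (fun u => / (1 + u ^ 2)) (fun _ => 1)
    0 (x * i) ltac:(nra)).
  rewrite atan_0, !Rminus_0_r in g; unfold be; rewrite xt.
  eapply Rle_trans; [apply Rle_abs|]; apply g.
  - intros u hu; auto_derive; [trivial|]; unfold Rsqr; field; nra.
  - intros u hu; auto_derive; trivial; ring.
  - intros u hu; assert (p := pow2_ge_0 u); rewrite Rabs_pos_eq.
    + rewrite <- Rinv_1 at 2; apply Rinv_le_contravar; lra.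
    + apply Rlt_le, Rinv_0_lt_compat; lra. }
assert (x2 : x ^ 2 <= 25 / 4) by nra.
assert (x3 : x ^ 3 <= 125 / 8) by nra.
assert (x0 : 0 <= x ^ 2 /\ 0 <= x ^ 3) by nra.
assert (ii : i ^ 2 <= i / 100) by nra.
assert (r1 : Rabs (t * be - x) <= 16 / 3 * i / 100).
{ replace (t * be - x) with (t * (be - x * i))
    by (rewrite Rmult_minus_distr_l; replace (t * (x * i)) with (x * (t * i)) by ring;
        rewrite ti; ring).
  rewrite Rabs_mult, (Rabs_pos_eq t) by lra.
  apply Rle_trans with (t * ((x * i) ^ 3 / 3)); [apply Rmult_le_compat_l; lra|].
  replace (t * ((x * i) ^ 3 / 3)) with (x ^ 3 / 3 * i ^ 2 * (t * i)) by field.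
  rewrite ti; nra. }
assert (al2 : al <= 25 / 8 * i / 100).
{ replace ((x * i) ^ 2 / 2) with (x ^ 2 * i ^ 2 / 2) in a1 by field.
  assert (x ^ 2 * i ^ 2 <= 25 / 4 * (i / 100)) by nra; lra. }
assert (tal : t * al <= 25 / 8 * i).
{ apply Rle_trans with (t * ((x * i) ^ 2 / 2)); [apply Rmult_le_compat_l; lra|].
  replace (t * ((x * i) ^ 2 / 2)) with (x ^ 2 / 2 * i * (t * i)) by field.
  rewrite ti; nra. }
assert (tal0 : 0 <= t * al) by nra.
assert (re : Rabs ((x - 1 / 2) * al + t * be - x) <= 1 / 2 * i).
{ replace ((x - 1 / 2) * al + t * be - x) with ((x - 1 / 2) * al + (t * be - x)) by ring.
  eapply Rle_trans; [apply Rabs_triang|].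
  rewrite (Rabs_pos_eq (_ * al)) by nra.
  assert ((x - 1 / 2) * al <= 2 * (25 / 8 * i / 100)) by (apply Rmult_le_compat; lra); lra. }
assert (im : Rabs (- (x - 1 / 2) * be + t * al) <= 8.2 * i).
{ assert ((x - 1 / 2) * be <= 2 * (5 / 2 * i)).
  { apply Rmult_le_compat; nra. }
  assert (0 <= (x - 1 / 2) * be) by nra.
  apply Rabs_le; lra. }
unfold Rdiv; fold i; unfold Re, Im; simpl; lra.
Qed.

(* [t * atan (t / x) <= pi t / 2] cancels against the growth of the
   trigonometric factors. *)
Lemma Cmod_inv_Gamma_le (sg t : R) : -1 < sg -> sg <> 0 -> 0 <= t ->
  Cmod (/ Gamma (sg, t))%C <=
  Cmod (sg, t) * Cmod ((sg + 1)%R, t)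
    * exp (- (sg + 3 / 2) * ln (Cmod ((sg + 2)%R, t)) + PI * t / 2 + (sg + 4 / 3)).
Proof.
intros s1 s0 t0.
assert (n0 : ((sg, t) : C) <> RtoC 0).
{ intros e; apply (f_equal fst) in e; now simpl in e. }
assert (n1 : (((sg + 1)%R, t) : C) <> RtoC 0).
{ intros e; apply (f_equal fst) in e; simpl in e; lra. }
rewrite Gamma_formula by assumption.
replace ((sg, t) + RtoC 1)%C with ((sg + 1)%R, t) by (apply C_ext; simpl; ring).
replace ((sg, t) + RtoC 2)%C with ((sg + 2)%R, t) by (apply C_ext; simpl; ring).
set (E := (lam _ + _ + _)%C).
replace (/ (cexp E / ((sg, t) * ((sg + 1)%R, t))))%C
  with ((sg, t) * ((sg + 1)%R, t) * cexp (- E))%C.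
2: { rewrite cexp_opp; field; repeat split; trivial; apply cexp_neq0. }
rewrite !Cmod_mult, Cmod_cexp.
apply Rmult_le_compat_l; [apply Rmult_le_pos; apply Cmod_ge_0|].
apply exp_le.
assert (c := stirling_const_bound); assert (d := Dl_le (sg + 2) t ltac:(lra)).
assert (cm : ln (Cmod ((sg + 2)%R, t)) = ln ((sg + 2) ^ 2 + t ^ 2) / 2).
{ assert (p : 0 < Cmod ((sg + 2)%R, t)).
  { apply Cmod_gt_0; intros e; apply (f_equal fst) in e; simpl in e; lra. }
  replace ((sg + 2) ^ 2 + t ^ 2) with (Cmod ((sg + 2)%R, t) * Cmod ((sg + 2)%R, t)).
  - rewrite ln_mult by lra; field.
  - replace (_ * _) with (Cmod ((sg + 2)%R, t) ^ 2) by ring; now rewrite Cmod2_alt. }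
assert (at1 : t * atan (t / (sg + 2)) <= PI * t / 2).
{ assert (b := atan_bound (t / (sg + 2))); nra. }
assert (eE : Re (- E)%C = - ((sg + 3 / 2) * ln (Cmod ((sg + 2)%R, t))
    - t * atan (t / (sg + 2)) - (sg + 2)) - Re stirling_const - Re (Dl ((sg + 2)%R, t))).
{ unfold E, lam, clog; rewrite cm; unfold Re, Im; simpl; field; lra. }
rewrite eE; revert d; unfold Rabs; destruct Rcase_abs; lra.
Qed.

Lemma exp_pow_INR (x : R) (n : nat) : exp x ^ n = exp (INR n * x).
Proof.
induction n as [|n IH]; [simpl; now rewrite Rmult_0_l, exp_0|].
rewrite S_INR, Rmult_plus_distr_r, Rmult_1_l, exp_plus, <- IH; simpl; ring.
Qed.

Lemma Cmod_le_re (a b t : R) : Rabs a <= Rabs b -> Cmod (a, t) <= Cmod (b, t).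
Proof.
intros h; apply sqrt_le_1_alt; simpl.
assert (q := Rsqr_le_abs_1 _ _ h); unfold Rsqr in q; lra.
Qed.

Lemma pair_plus_RtoC (a t b : R) : ((a, t) + RtoC b)%C = ((a + b)%R, t).
Proof. apply C_ext; simpl; ring. Qed.

(** Near the real axis [|s|] and [|s + 1|] may be smaller than [|s + 2|], so these factors of the
    denominator are cancelled against the numerator [(s (s + 1))^n] coming from [1 / Gamma^n]. What
    is left of that numerator is bounded above by powers of [|s + 2|], and the factors [s + k] with
    [k >= 2] are bounded below by [|s + 2|]. *)
Lemma Cmod_rising_ge (sg t : R) (m p : nat) : -1 <= sg ->
  (Cmod (sg, t) * Cmod ((sg + 1)%R, t)) ^ S m * Cmod ((sg + 2)%R, t) ^ S p <=
  Cmod (rising (sg, t) (S p)) * Cmod ((sg + 2)%R, t) ^ (2 * S m).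
Proof.
intros hs.
set (Z := Cmod ((sg + 2)%R, t)); set (u := Cmod (sg, t)); set (v := Cmod ((sg + 1)%R, t)).
assert (u0 : 0 <= u) by apply Cmod_ge_0.
assert (v0 : 0 <= v) by apply Cmod_ge_0.
assert (uZ : u <= Z).
{ apply Cmod_le_re; rewrite (Rabs_pos_eq (sg + 2)) by lra; apply Rabs_le; lra. }
assert (vZ : v <= Z) by (apply Cmod_le_re; rewrite !Rabs_pos_eq; lra).
assert (uv : (u * v) ^ m <= Z ^ (2 * m)).
{ rewrite pow_mult; apply pow_incr; simpl; split; nra. }
assert (uv0 : 0 <= (u * v) ^ m) by (apply pow_le; nra).
assert (Zm : 0 <= Z ^ (2 * m)) by (apply pow_le; lra).
assert (ZS : Z ^ (2 * S m) = Z ^ (2 * m) * (Z * Z)).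
{ replace (2 * S m)%nat with (2 * m + 2)%nat by lia; rewrite pow_add; simpl; ring. }
induction p as [|p IH].
- simpl rising; rewrite Cmult_1_l, Cplus_0_r; fold u.
  rewrite pow_1, ZS.
  replace ((u * v) ^ S m * Z) with (u * (u * v) ^ m * (v * Z)) by (simpl; ring).
  replace (u * (Z ^ (2 * m) * (Z * Z))) with (u * Z ^ (2 * m) * (Z * Z)) by ring.
  apply Rmult_le_compat; try nra; apply Rmult_le_compat; nra.
- change (rising (sg, t) (S (S p))) with
    (rising (sg, t) (S p) * ((sg, t) + RtoC (INR (S p))))%C.
  rewrite Cmod_mult, pair_plus_RtoC.
  destruct p as [|p].
  + simpl rising; rewrite Cmult_1_l, Cplus_0_r; fold u; simpl INR; fold v.
    rewrite ZS; replace ((u * v) ^ S m * Z ^ 2) with (u * v * ((u * v) ^ m * (Z * Z)))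
      by (simpl; ring).
    apply Rmult_le_compat_l; [nra|]; apply Rmult_le_compat_r; nra.
  + assert (big : Z <= Cmod ((sg + INR (S (S p)))%R, t)).
    { apply Cmod_le_re; assert (h := pos_INR p); rewrite !S_INR, !Rabs_pos_eq; lra. }
    assert (r0 := Cmod_ge_0 (rising (sg, t) (S (S p)))).
    replace ((u * v) ^ S m * Z ^ S (S (S p))) with
      ((u * v) ^ S m * Z ^ S (S p) * Z) by (simpl; ring).
    assert (ZZ : 0 <= Z ^ (2 * S m)) by (apply pow_le; lra).
    apply Rle_trans with (Cmod (rising (sg, t) (S (S p))) * Z ^ (2 * S m) * Z).
    * apply Rmult_le_compat_r; lra.
    * rewrite !Rmult_assoc; apply Rmult_le_compat_l; [exact r0|].
      rewrite Rmult_comm; apply Rmult_le_compat_r; assumption.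
Qed.

(* [p = n] gives the integrand of the kernel, [p = 0] that of its derivative. *)
Definition integrand (p n r1 r2 : nat) (D : ssrint.int) (w : R) (s : C) : C :=
  (rcpow w (s + RtoC (INR p)) / rising s (S p) * / fe_factor n r1 r2 D s)%C.

(** The logarithm of [B] in [|H| <= B / sqrt |s + 2|]. Per unit of degree, [ln 8] comes from the
    trigonometric factors, and [sg + 4/3] is [sg + 2 - 5/6 + 1/6], from [lam], the Stirling constant
    and [Dl]. *)
Definition log_bound (p n : nat) (D : ssrint.int) (w sg : R) : R :=
  (sg + INR p) * ln w + (1 / 2 - sg) * ln (INR (ssrint.absz D))
  + INR n * (sg * ln 2 - ln 2 + sg * ln PI + ln 8 + (sg + 4 / 3)).

(** The line avoids the poles of [Gamma], and the sine and cosine of [pi s / 2] are at least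
    [exp (pi t / 2) / 8] in modulus, with a constant independent of [n]. *)
Definition admissible (sg : R) : Prop :=
  -1 < sg < 1 / 2 /\ sg <> 0 /\
  1 / 4 <= Rabs (cos (PI * sg / 2)) /\ 1 / 4 <= Rabs (sin (PI * sg / 2)).

Lemma Cmod_rcpow (a : R) (s : C) : Cmod (rcpow a s) = exp (Re s * ln a).
Proof. unfold rcpow; rewrite Cmod_cexp; f_equal; destruct s; simpl; ring. Qed.

Lemma rcpow_neq0 (a : R) (s : C) : rcpow a s <> RtoC 0.
Proof. apply cexp_neq0. Qed.

Lemma factors_neq0 (sg t : R) (p : nat) : admissible sg ->
  rising (sg, t) (S p) <> RtoC 0 /\
  ccos (RtoC PI * (sg, t) / RtoC 2)%C <> RtoC 0 /\
  csin (RtoC PI * (sg, t) / RtoC 2)%C <> RtoC 0 /\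
  Gamma (sg, t) <> RtoC 0.
Proof.
intros [s1 [s0 [hc hs]]].
assert (sh : forall b, sg + b <> 0 -> ((sg, t) + RtoC b)%C <> RtoC 0).
{ intros b hb e; apply (f_equal fst) in e; simpl in e; lra. }
split; [|split; [|split]].
- assert (all : forall m, rising (sg, t) m <> RtoC 0).
  { induction m as [|m IH].
    - intros e; apply (f_equal fst) in e; simpl in e; lra.
    - apply Cmult_neq_0; [exact IH|]; apply sh.
      destruct m; [simpl; lra|]; rewrite S_INR; assert (h := pos_INR m); lra. }
  apply all.
- rewrite trig_arg; apply Cmod_gt_0.
  assert (h := Cmod_ccos_ge _ (PI * t / 2) hc); assert (q := exp_pos (PI * t / 2)); lra.
- rewrite trig_arg; apply Cmod_gt_0.
  assert (h := Cmod_csin_ge _ (PI * t / 2) hs); assert (q := exp_pos (PI * t / 2)); lra.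
- rewrite Gamma_formula; [|exact (proj1 s1)|intros e; apply (f_equal fst) in e; simpl in e; lra].
  unfold Cdiv; apply Cmult_neq_0; [apply cexp_neq0|].
  assert (n0 : ((sg, t) * ((sg, t) + RtoC 1))%C <> RtoC 0).
  { apply Cmult_neq_0; [|apply sh; lra].
    intros e; apply (f_equal fst) in e; simpl in e; lra. }
  apply Cmod_gt_0; rewrite Cmod_inv by exact n0.
  now apply Rinv_0_lt_compat, Cmod_gt_0.
Qed.

Lemma inv_fe_factor (n r1 r2 : nat) (D : ssrint.int) (sg t : R) : admissible sg ->
  (/ fe_factor n r1 r2 D (sg, t))%C =
  (/ (rcpow 2 (RtoC 1 - (sg, t)) / rcpow PI (sg, t)) ^ n
   * / rcpow (INR (ssrint.absz D)) ((sg, t) - RtoC (1 / 2))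
   * / ccos (RtoC PI * (sg, t) / RtoC 2) ^ (r1 + r2)
   * / csin (RtoC PI * (sg, t) / RtoC 2) ^ r2
   * (/ Gamma (sg, t)) ^ n)%C.
Proof.
intros adm; destruct (factors_neq0 sg t 0 adm) as [_ [hc [hs hg]]].
rewrite Cpow_inv by exact hg; unfold fe_factor.
change (ssrnat.addn r1 r2) with (r1 + r2)%nat.
assert (p1 : (rcpow 2 (RtoC 1 - (sg, t)) / rcpow PI (sg, t))%C <> RtoC 0).
{ unfold Cdiv, rcpow; rewrite <- cexp_opp, <- cexp_add; apply cexp_neq0. }
assert (p2 := rcpow_neq0 (INR (ssrint.absz D)) ((sg, t) - RtoC (1 / 2))%C).
field; repeat split; trivial; apply Cpow_nz; assumption.
Qed.

(** The total power of [|s + 2|] is [- n (sg + 3/2) + 2 n - (p + 1)], which the equation for [sg]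
    turns into [-1/2]. The growth [exp (n pi t / 2)] of [1 / Gamma^n] is compensated by the
    [r1 + 2 r2 = n] trigonometric factors. *)
Lemma Cmod_integrand_le (p n r1 r2 : nat) (D : ssrint.int) (w sg t : R) :
  (1 <= n)%nat -> (r1 + 2 * r2 = n)%nat -> admissible sg ->
  INR n * (1 / 2 - sg) = INR p + 1 / 2 -> 0 <= t ->
  Cmod (integrand p n r1 r2 D w (sg, t)) <=
    exp (log_bound p n D w sg) * / sqrt (Cmod ((sg + 2)%R, t)).
Proof.
intros n1 hn adm hsg t0.
destruct (factors_neq0 sg t p adm) as [nr [nc [ns ng]]].
assert (adm' := adm); destruct adm' as [s1 [s0 [hc hs]]].
unfold integrand; rewrite inv_fe_factor by exact adm.
set (Z := Cmod ((sg + 2)%R, t)).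
assert (Z0 : 0 < Z).
{ apply Cmod_gt_0; intros e; apply (f_equal fst) in e; simpl in e; lra. }
assert (n1' : (rcpow 2 (RtoC 1 - (sg, t)) / rcpow PI (sg, t))%C <> RtoC 0).
{ unfold Cdiv, rcpow; rewrite <- cexp_opp, <- cexp_add; apply cexp_neq0. }
rewrite Cmod_mult, Cmod_div by exact nr.
rewrite !Cmod_mult, !Cmod_inv, !Cmod_pow by (try apply Cpow_nz; trivial; apply rcpow_neq0).
rewrite Cmod_div by apply rcpow_neq0.
rewrite !Cmod_rcpow.
set (P3 := Cmod (ccos _)); set (P4 := Cmod (csin _)).
set (G := Cmod (/ Gamma _)%C).
set (uv := Cmod (sg, t) * Cmod ((sg + 1)%R, t)).
set (Rp := Cmod (rising _ _)).
assert (Rp0 : 0 < Rp) by now apply Cmod_gt_0.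
assert (hG := Cmod_inv_Gamma_le sg t ltac:(lra) s0 t0); fold G uv Z in hG.
assert (G0 : 0 <= G) by apply Cmod_ge_0.
set (g := - (sg + 3 / 2) * ln Z + PI * t / 2 + (sg + 4 / 3)) in hG.
assert (hGn : G ^ n <= uv ^ n * exp (INR n * g)).
{ rewrite <- exp_pow_INR, <- Rpow_mult_distr; now apply pow_incr. }
assert (h8 : exp (PI * t / 2) / 8 = exp (PI * t / 2 - ln 8)).
{ unfold Rminus; rewrite exp_plus, exp_Ropp, exp_ln by lra; reflexivity. }
assert (h3 : exp (PI * t / 2 - ln 8) <= P3).
{ rewrite <- h8; unfold P3; rewrite trig_arg; now apply Cmod_ccos_ge. }
assert (h4 : exp (PI * t / 2 - ln 8) <= P4).
{ rewrite <- h8; unfold P4; rewrite trig_arg; now apply Cmod_csin_ge. }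
set (E := exp (PI * t / 2 - ln 8)) in *.
assert (E0 : 0 < E) by apply exp_pos.
assert (h34 : / P3 ^ (r1 + r2) * / P4 ^ r2 <= exp (- (INR n * (PI * t / 2 - ln 8)))).
{ rewrite exp_Ropp, <- exp_pow_INR; fold E.
  rewrite <- Rinv_mult; apply Rinv_le_contravar; [now apply pow_lt|].
  replace n with ((r1 + r2) + r2)%nat by lia; rewrite pow_add.
  apply Rmult_le_compat; try (apply pow_le; lra); apply pow_incr; lra. }
assert (hr : uv ^ n * / Rp <= exp ((2 * INR n - (INR p + 1)) * ln Z)).
{ destruct n as [|m]; [lia|].
  assert (h := Cmod_rising_ge sg t m p ltac:(lra)); fold uv Z Rp in h.
  apply (Rmult_le_reg_r (Rp * Z ^ S p)); [apply Rmult_lt_0_compat; [lra|now apply pow_lt]|].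
  replace (uv ^ S m * / Rp * (Rp * Z ^ S p)) with (uv ^ S m * Z ^ S p) by (field; lra).
  eapply Rle_trans; [exact h|right].
  replace (Z ^ (2 * S m)) with (exp (2 * INR (S m) * ln Z)).
  - replace (Z ^ S p) with (exp ((INR p + 1) * ln Z)).
    + rewrite (Rmult_comm Rp (exp ((INR p + 1) * ln Z))), <- Rmult_assoc, <- exp_plus.
      rewrite Rmult_comm; f_equal; f_equal; ring.
    + rewrite <- S_INR, <- exp_pow_INR, exp_ln; trivial.
  - replace (2 * INR (S m)) with (INR (2 * S m)) by (rewrite mult_INR; simpl; ring).
    rewrite <- exp_pow_INR, exp_ln; trivial. }
assert (P3p : 0 < / P3 ^ (r1 + r2)) by (apply Rinv_0_lt_compat, pow_lt; lra).
assert (P4p : 0 < / P4 ^ r2) by (apply Rinv_0_lt_compat, pow_lt; lra).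
assert (e1 : / (exp (Re (RtoC 1 - (sg, t))%C * ln 2) / exp (Re (sg, t) * ln PI)) ^ n
   = exp (INR n * (sg * ln 2 - ln 2 + sg * ln PI))).
{ unfold Rdiv; rewrite <- exp_Ropp, <- exp_plus, exp_pow_INR, <- exp_Ropp; f_equal.
  simpl; ring. }
assert (e2 : / exp (Re ((sg, t) - RtoC (1 / 2))%C * ln (INR (ssrint.absz D)))
   = exp ((1 / 2 - sg) * ln (INR (ssrint.absz D)))).
{ rewrite <- exp_Ropp; f_equal; simpl; ring. }
assert (e3 : exp (Re ((sg, t) + RtoC (INR p))%C * ln w) = exp ((sg + INR p) * ln w)).
{ reflexivity. }
rewrite e1, e2, e3.
set (x1 := exp (INR n * _)); set (x2 := exp ((1 / 2 - sg) * _)); set (x3 := exp (_ * ln w)).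
assert (p1 : 0 < x1) by apply exp_pos; assert (p2 : 0 < x2) by apply exp_pos.
assert (p3 : 0 < x3) by apply exp_pos.
replace (x3 / Rp * (x1 * x2 * / P3 ^ (r1 + r2) * / P4 ^ r2 * G ^ n)) with
  (x1 * x2 * x3 * ((/ P3 ^ (r1 + r2) * / P4 ^ r2) * (G ^ n * / Rp)))
  by (unfold Rdiv; ring).
apply Rle_trans with (x1 * x2 * x3 * (exp (- (INR n * (PI * t / 2 - ln 8)))
   * (exp (INR n * g) * exp ((2 * INR n - (INR p + 1)) * ln Z)))).
- apply Rmult_le_compat_l; [apply Rlt_le; repeat apply Rmult_lt_0_compat; assumption|].
  apply Rmult_le_compat; [apply Rlt_le, Rmult_lt_0_compat; assumption| |exact h34|].
  + apply Rmult_le_pos; [now apply pow_le|]; apply Rlt_le, Rinv_0_lt_compat; lra.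
  + apply Rle_trans with (uv ^ n * exp (INR n * g) * / Rp).
    * apply Rmult_le_compat_r; [apply Rlt_le, Rinv_0_lt_compat; lra|exact hGn].
    * rewrite (Rmult_comm (uv ^ n)), Rmult_assoc; apply Rmult_le_compat_l; [|exact hr].
      apply Rlt_le, exp_pos.
- right; replace (/ sqrt Z) with (exp (- (1 / 2) * ln Z)).
  + unfold x1, x2, x3; rewrite <- !exp_plus; f_equal; unfold log_bound, g.
    replace (2 * INR n - (INR p + 1)) with (INR n * (sg + 3 / 2) - 1 / 2) by lra.
    field.
  + rewrite <- (sqrt_sqrt Z) at 1 by lra; assert (q := sqrt_lt_R0 Z Z0).
    rewrite ln_mult by exact q.
    rewrite <- (exp_ln (sqrt Z)) at 3 by exact q.
    rewrite <- exp_Ropp; f_equal; field.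
Qed.

(** * Asymptotic form of the integrand *)

Lemma rising_polar (sg t : R) (m : nat) : -1 <= sg <= 1 -> 0 < t ->
  exists v : C, rising (sg, t) m = (cexp (RtoC (INR m) * clogI t) * v)%C /\
    near1 v (INR m * (INR m + 1) / 2 / t).
Proof.
intros hs t0; induction m as [|m [v [e nv]]].
- exists (RtoC 1); split.
  + simpl; replace (RtoC 0 * clogI t)%C with (RtoC 0) by ring; rewrite cexp_0; ring.
  + eapply near1_weaken; [|apply near1_1]; simpl; right; field; lra.
- exists (v * (((sg + INR m)%R, t) / cexp (clogI t)))%C; split.
  + change (rising (sg, t) (S m)) with (rising (sg, t) m * ((sg, t) + RtoC (INR m)))%C.
    rewrite e, pair_plus_RtoC, S_INR, RtoC_plus, Cmult_plus_distr_r, Cmult_1_l, cexp_add.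
    field; apply cexp_neq0.
  + eapply near1_weaken; [|apply near1_mult; [exact nv|apply near1_ratio; exact t0]].
    assert (h : Rabs (sg + INR m) <= INR m + 1).
    { assert (q := pos_INR m); apply Rabs_le; lra. }
    rewrite S_INR.
    replace ((INR m + 1) * (INR m + 1 + 1) / 2 / t) with
      (INR m * (INR m + 1) / 2 / t + (INR m + 1) / t) by (field; lra).
    apply Rplus_le_compat_l; unfold Rdiv; apply Rmult_le_compat_r; [|exact h].
    now apply Rlt_le, Rinv_0_lt_compat.
Qed.

Definition gamma_log (sg t : R) : C :=
  (lam_main (sg + 2) t + stirling_const - RtoC 2 * clogI t)%C.

(** The 12 covers 9 from [lam], 1/3 from [Dl], and [1 + 3/2] from the factors [s] and [s + 1]. *)
Lemma Gamma_polar (sg t : R) : -1 < sg < 1 / 2 -> sg <> 0 -> 100 <= t ->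
  exists v : C, Gamma (sg, t) = (cexp (gamma_log sg t) * v)%C /\ near1 v (12 / t).
Proof.
intros hs s0 ht.
assert (L0 := cexp_neq0 (clogI t)).
exists (cexp (lam ((sg + 2)%R, t) - lam_main (sg + 2) t) * cexp (Dl ((sg + 2)%R, t))
  * / (((sg, t) / cexp (clogI t)) * (((sg + 1)%R, t) / cexp (clogI t))))%C.
split.
- rewrite Gamma_formula; [|simpl; lra|intros e; apply (f_equal fst) in e; simpl in e; lra].
  rewrite !pair_plus_RtoC; unfold gamma_log.
  replace (lam ((sg + 2)%R, t) + stirling_const + Dl ((sg + 2)%R, t))%C with
    (lam_main (sg + 2) t + stirling_const
     + (lam ((sg + 2)%R, t) - lam_main (sg + 2) t) + Dl ((sg + 2)%R, t))%C by ring.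
  replace (lam_main (sg + 2) t + stirling_const - RtoC 2 * clogI t)%C with
    (lam_main (sg + 2) t + stirling_const + - clogI t + - clogI t)%C
    by (apply C_ext; simpl; ring).
  rewrite !cexp_add, !cexp_opp; field; repeat split; trivial;
    intros e; apply (f_equal snd) in e; simpl in e; lra.
- eapply near1_weaken.
  2: { apply near1_mult; [apply near1_mult; [apply near1_lam; lra|apply near1_cexp]|].
       apply near1_inv, near1_mult; apply near1_ratio; lra. }
  destruct (Dl_le_inv (sg + 2) t ltac:(lra) ltac:(lra)) as [dr di].
  assert (a1 : Rabs sg <= 1) by (apply Rabs_le; lra).
  assert (a2 : Rabs (sg + 1) <= 3 / 2) by (apply Rabs_le; lra).
  replace (/ (6 * t)) with (/ 6 * / t) in dr, di by (field; lra).
  unfold Rdiv; set (i := / t) in *.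
  assert (i0 : 0 < i) by (unfold i; apply Rinv_0_lt_compat; lra); nra.
Qed.

(** The complex exponent of the whole integrand: its real part carries the amplitude, its imaginary
    part the oscillation. *)
Definition phase (p n r1 r2 : nat) (D : ssrint.int) (w sg t : R) : C :=
  (((sg, t) + RtoC (INR p)) * RtoC (ln w) - RtoC (INR (S p)) * clogI t
   - RtoC (INR n) * ((RtoC 1 - (sg, t)) * RtoC (ln 2) - (sg, t) * RtoC (ln PI))
   - ((sg, t) - RtoC (1 / 2)) * RtoC (ln (INR (ssrint.absz D)))
   - RtoC (INR (r1 + r2)) * trig_log sg t
   - RtoC (INR r2) * (trig_log sg t + (0, PI / 2)%R)
   - RtoC (INR n) * gamma_log sg t)%C.

(** The errors, in units of [1 / t], are [(p + 1) (p + 2) / 2] from the rising product, [n] from the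
    trigonometric factors and [12 n] from [Gamma]; for [p <= n] and [n >= 2] their sum is at most
    [10 n^2]. *)
Lemma integrand_polar (p n r1 r2 : nat) (D : ssrint.int) (w sg t : R) :
  (2 <= n)%nat -> (p <= n)%nat -> (r1 + 2 * r2 = n)%nat -> admissible sg -> 100 <= t ->
  exists v : C, integrand p n r1 r2 D w (sg, t) = (cexp (phase p n r1 r2 D w sg t) * v)%C
    /\ near1 v (10 * INR n ^ 2 / t).
Proof.
intros n2 pn hn adm ht.
destruct (factors_neq0 sg t p adm) as [nr [nc [ns ng]]].
assert (adm' := adm); destruct adm' as [s1 [s0 _]].
destruct (rising_polar sg t (S p) ltac:(lra) ltac:(lra)) as [vr [er hr]].
destruct (Gamma_polar sg t s1 s0 ht) as [vg [eg hg]].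
destruct (near1_trig sg t ltac:(lra)) as [hc hs].
set (vc := (RtoC 1 + cexp (nome sg t))%C) in *.
set (vs := (RtoC 1 - cexp (nome sg t))%C) in *.
exists (/ (vr * vc ^ (r1 + r2) * vs ^ r2 * vg ^ n))%C; split.
- unfold integrand; rewrite inv_fe_factor by exact adm.
  rewrite Cpow_inv by exact ng.
  rewrite er, eg, ccos_polar, csin_polar; fold vc vs.
  unfold phase, rcpow, Cdiv, Cminus.
  rewrite <- !cexp_opp, <- !cexp_add, !Cpow_mult_l, !cexp_pow.
  rewrite !cexp_add, !cexp_opp.
  replace (cexp (RtoC (INR n) * ((RtoC 1 + - (sg, t)) * RtoC (ln 2)
             + - ((sg, t) * RtoC (ln PI))))%C)
    with (cexp (RtoC (INR n) * ((RtoC 1 + - (sg, t)) * RtoC (ln 2))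
             + - (RtoC (INR n) * ((sg, t) * RtoC (ln PI)))))%C
    by (f_equal; ring).
  destruct hr as [vr0 _]; destruct hc as [vc0 _]; destruct hs as [vs0 _].
  destruct hg as [vg0 _].
  field; repeat split; try apply cexp_neq0; try assumption; now apply Cpow_nz.
- apply near1_inv; eapply near1_weaken.
  2: { apply near1_mult; [apply near1_mult; [apply near1_mult|]|].
       - exact hr.
       - apply near1_pow; exact hc.
       - apply near1_pow; exact hs.
       - apply near1_pow; exact hg. }
  assert (N2 : 2 <= INR n) by (apply (le_INR 2); exact n2).
  assert (P : INR (S p) <= INR n + 1) by (rewrite <- S_INR; apply le_INR; lia).
  assert (P0 := pos_INR (S p)).
  assert (hR : INR (r1 + r2) + INR r2 = INR n) by (rewrite <- plus_INR; f_equal; lia).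
  set (i := / t); assert (i0 : 0 < i) by (unfold i; apply Rinv_0_lt_compat; lra).
  unfold Rdiv; fold i.
  replace (INR (S p) * (INR (S p) + 1) * / 2 * i + INR (r1 + r2) * i + INR r2 * i
           + INR n * (12 * i)) with
    ((INR (S p) * (INR (S p) + 1) * / 2 + (INR (r1 + r2) + INR r2) + INR n * 12) * i) by ring.
  rewrite hR; apply Rmult_le_compat_r; [lra|]; nra.
Qed.

Definition main_log (p n : nat) (D : ssrint.int) (w sg : R) : R :=
  (sg + INR p) * ln w + (1 / 2 - sg) * ln (INR (ssrint.absz D))
  + INR n * (sg * ln 2 - ln 2 + sg * ln PI + ln 2 - Re stirling_const).

(** This is [2 pi (w / |D|)^(1/n)]; as an exponential it is visibly positive. *)
Definition stationary (n : nat) (D : ssrint.int) (w : R) : R :=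
  exp (ln 2 + ln PI + (ln w - ln (INR (ssrint.absz D))) / INR n).

Definition phase_shift (p n r2 : nat) (sg : R) : R :=
  - (INR p + 1) * (PI / 2) + INR n * (PI * sg / 2) - INR r2 * (PI / 2)
  - INR n * ((sg + 3 / 2) * (PI / 2) + Im stirling_const - PI).

(** The terms [pi t / 2] cancel through [r1 + 2 r2 = n], and the equation for [sg] leaves [ln t]
    with coefficient [-1/2]. In the imaginary part, everything linear in [t] goes into [ln t0]. *)
Lemma phase_coord (p n r1 r2 : nat) (D : ssrint.int) (w sg t : R) :
  (1 <= n)%nat -> (r1 + 2 * r2 = n)%nat -> INR n * (1 / 2 - sg) = INR p + 1 / 2 ->
  phase p n r1 r2 D w sg t =
  ((main_log p n D w sg - ln t / 2)%R,
   (INR n * t * (ln (stationary n D w) - ln t + 1) + phase_shift p n r2 sg)%R).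
Proof.
intros n1 hn hsg.
assert (N1 : 1 <= INR n) by (apply (le_INR 1); exact n1).
assert (hR : INR (r1 + r2) = INR n - INR r2).
{ rewrite <- hn, !plus_INR, mult_INR; simpl; ring. }
assert (hp : INR p = INR n * (1 / 2 - sg) - 1 / 2) by lra.
unfold phase, gamma_log, lam_main, trig_log, clogI, main_log, stationary, phase_shift.
rewrite ln_exp, hR, S_INR, hp; apply C_ext; simpl; field; lra.
Qed.

Lemma main_log_le (p n : nat) (D : ssrint.int) (w sg : R) : -1 < sg ->
  main_log p n D w sg <= log_bound p n D w sg.
Proof.
intros hs; unfold main_log, log_bound; apply Rplus_le_compat_l.
apply Rmult_le_compat_l; [apply pos_INR|].
assert (c := stirling_const_bound).
assert (l := ln_le 2 8 ltac:(lra) ltac:(lra)); lra.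
Qed.

Lemma integrand_osc (p n r1 r2 : nat) (D : ssrint.int) (w sg t : R) :
  (2 <= n)%nat -> (p <= n)%nat -> (r1 + 2 * r2 = n)%nat -> admissible sg ->
  INR n * (1 / 2 - sg) = INR p + 1 / 2 -> 25 * INR n ^ 2 <= t ->
  Rabs (Re (integrand p n r1 r2 D w (sg, t))
        - exp (main_log p n D w sg)
          * osc (INR n) (stationary n D w) (phase_shift p n r2 sg) t)
  <= 20 * INR n ^ 2 * exp (log_bound p n D w sg) * / (t * sqrt t).
Proof.
intros n2 pn hn adm hsg ht.
assert (N2 : 2 <= INR n) by (apply (le_INR 2); exact n2).
assert (t100 : 100 <= t) by nra.
destruct (integrand_polar p n r1 r2 D w sg t n2 pn hn adm t100) as [v [e [_ [hv _]]]].
assert (st := sqrt_lt_R0 t ltac:(lra)).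
assert (half : exp (- (ln t / 2)) = / sqrt t).
{ rewrite <- (sqrt_sqrt t) at 1 by lra; rewrite ln_mult by exact st.
  rewrite <- (exp_ln (sqrt t)) at 3 by exact st.
  rewrite <- exp_Ropp; f_equal; field. }
set (E := cexp (phase p n r1 r2 D w sg t)) in *.
assert (mE : Cmod E = exp (main_log p n D w sg) * / sqrt t).
{ unfold E; rewrite Cmod_cexp, phase_coord by (trivial; lia).
  unfold Re; simpl fst; unfold Rminus; now rewrite exp_plus, half. }
assert (rE : Re E = exp (main_log p n D w sg)
   * osc (INR n) (stationary n D w) (phase_shift p n r2 sg) t).
{ unfold E; rewrite phase_coord by (trivial; lia).
  unfold cexp, Re, Im; cbn [fst snd]; unfold Rminus at 1; rewrite exp_plus, half.
  unfold osc, Rdiv; ring. }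
rewrite <- rE, e.
replace (Re (E * v)%C - Re E) with (Re (E * (v - RtoC 1))%C)
  by (destruct E, v; simpl; ring).
eapply Rle_trans; [apply re_le_Cmod|]; rewrite Cmod_mult, mE.
(* From [t >= 25 n^2] the exponent is at most 2/5, so [exp e - 1 <= 2 e] applies and 10 becomes
   20. *)
assert (small : 0 <= 10 * INR n ^ 2 / t <= 1 / 2).
{ split; [apply Rdiv_le_0_compat; nra|].
  apply (Rmult_le_reg_r t); [lra|]; unfold Rdiv; rewrite Rmult_assoc, Rinv_l by lra; lra. }
assert (x := exp_sub1_le _ small).
assert (b : Cmod (v - RtoC 1)%C <= 20 * INR n ^ 2 / t) by (unfold Rdiv in *; lra).
assert (ml := exp_le _ _ (main_log_le p n D w sg ltac:(destruct adm; lra))).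
assert (is : 0 < / sqrt t) by now apply Rinv_0_lt_compat.
apply Rle_trans with (exp (log_bound p n D w sg) * / sqrt t * (20 * INR n ^ 2 / t)).
- apply Rmult_le_compat; [|apply Cmod_ge_0| |exact b].
  + apply Rmult_le_pos; [apply Rlt_le, exp_pos|lra].
  + apply Rmult_le_compat_r; lra.
- right; field; lra.
Qed.

(** * Continuity and reality of the integrand *)

Definition ccont (f : R -> C) : Prop :=
  forall t, continuous (fun u => Re (f u)) t /\ continuous (fun u => Im (f u)) t.

Lemma ccont_ext (f g : R -> C) : (forall t, f t = g t) -> ccont f -> ccont g.
Proof.
intros e h t; destruct (h t) as [hr hi]; split.
- apply (continuous_ext (fun u => Re (f u))); [intros u; now rewrite e|exact hr].
- apply (continuous_ext (fun u => Im (f u))); [intros u; now rewrite e|exact hi].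
Qed.

Lemma ccont_const (c : C) : ccont (fun _ => c).
Proof. intros t; split; apply continuous_const. Qed.

Lemma ccont_vline (x : R) : ccont (fun t => (x, t)).
Proof. intros t; split; [apply continuous_const|apply continuous_id]. Qed.

Lemma ccont_plus (f g : R -> C) : ccont f -> ccont g -> ccont (fun t => f t + g t)%C.
Proof.
intros hf hg t; destruct (hf t) as [fr fi]; destruct (hg t) as [gr gi]; split.
- now apply (continuous_plus (fun u => Re (f u)) (fun u => Re (g u))).
- now apply (continuous_plus (fun u => Im (f u)) (fun u => Im (g u))).
Qed.

Lemma ccont_mult (f g : R -> C) : ccont f -> ccont g -> ccont (fun t => f t * g t)%C.
Proof.
intros hf hg t; destruct (hf t) as [fr fi]; destruct (hg t) as [gr gi]; split; simpl.
- apply (continuous_minus (fun u => Re (f u) * Re (g u)) (fun u => Im (f u) * Im (g u)));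
    [apply (continuous_mult (fun u => Re (f u)) (fun u => Re (g u)))
    |apply (continuous_mult (fun u => Im (f u)) (fun u => Im (g u)))]; assumption.
- apply (continuous_plus (fun u => Re (f u) * Im (g u)) (fun u => Im (f u) * Re (g u)));
    [apply (continuous_mult (fun u => Re (f u)) (fun u => Im (g u)))
    |apply (continuous_mult (fun u => Im (f u)) (fun u => Re (g u)))]; assumption.
Qed.

Lemma ccont_opp (f : R -> C) : ccont f -> ccont (fun t => - f t)%C.
Proof.
intros hf; apply ccont_ext with (fun t => RtoC (-1) * f t)%C.
- intros t; apply C_ext; simpl; ring.
- apply ccont_mult; [apply ccont_const|exact hf].
Qed.

Lemma ccont_minus (f g : R -> C) : ccont f -> ccont g -> ccont (fun t => f t - g t)%C.
Proof. intros hf hg; apply ccont_plus; [exact hf|now apply ccont_opp]. Qed.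

Lemma ccont_pow (f : R -> C) (n : nat) : ccont f -> ccont (fun t => f t ^ n)%C.
Proof.
intros hf; induction n as [|n IH]; [exact (ccont_const (RtoC 1))|].
apply ccont_ext with (fun t => f t * f t ^ n)%C; [intros; now rewrite Cpow_S|].
now apply ccont_mult.
Qed.

Lemma continuous_comp_derive (g f : R -> R) (t : R) :
  ex_derive g (f t) -> continuous f t -> continuous (fun u => g (f u)) t.
Proof.
intros hg hf; apply (continuous_comp f g); [exact hf|].
now apply (ex_derive_continuous g).
Qed.

Lemma continuous_Rinv_comp (f : R -> R) (t : R) :
  f t <> 0 -> continuous f t -> continuous (fun u => / f u) t.
Proof.
intros h0 hf; apply (continuous_comp_derive Rinv f t); [|exact hf].
auto_derive; trivial.
Qed.

Lemma ccont_inv (f : R -> C) : (forall t, f t <> RtoC 0) -> ccont f ->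
  ccont (fun t => / f t)%C.
Proof.
intros h0 hf t; destruct (hf t) as [fr fi].
assert (n0 : Re (f t) ^ 2 + Im (f t) ^ 2 <> 0).
{ intros e; apply (h0 t); apply C_ext; unfold Re, Im in e; simpl; nra. }
assert (cs : continuous (fun u => / (Re (f u) ^ 2 + Im (f u) ^ 2)) t).
{ apply (continuous_Rinv_comp (fun u => Re (f u) ^ 2 + Im (f u) ^ 2)); [exact n0|].
  apply (continuous_plus (fun u => Re (f u) ^ 2) (fun u => Im (f u) ^ 2));
    [apply (continuous_comp_derive (fun v => v ^ 2) (fun u => Re (f u)))
    |apply (continuous_comp_derive (fun v => v ^ 2) (fun u => Im (f u)))];
    try assumption; auto_derive; trivial. }
split; simpl.
- now apply (continuous_mult (fun u => Re (f u)) (fun u => / (Re (f u) ^ 2 + Im (f u) ^ 2))).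
- apply (continuous_mult (fun u => - Im (f u)) (fun u => / (Re (f u) ^ 2 + Im (f u) ^ 2)));
    [|exact cs].
  now apply (continuous_opp (fun u => Im (f u))).
Qed.

Lemma ccont_cexp (f : R -> C) : ccont f -> ccont (fun t => cexp (f t)).
Proof.
intros hf t; destruct (hf t) as [fr fi].
assert (ce : continuous (fun u => exp (Re (f u))) t).
{ apply (continuous_comp_derive exp (fun u => Re (f u))); [auto_derive; trivial|exact fr]. }
unfold cexp; split; simpl.
- apply (continuous_mult (fun u => exp (Re (f u))) (fun u => cos (Im (f u)))); [exact ce|].
  apply (continuous_comp_derive cos (fun u => Im (f u))); [auto_derive; trivial|exact fi].
- apply (continuous_mult (fun u => exp (Re (f u))) (fun u => sin (Im (f u)))); [exact ce|].
  apply (continuous_comp_derive sin (fun u => Im (f u))); [auto_derive; trivial|exact fi].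
Qed.

Lemma ccont_clog (x : R) : 0 < x -> ccont (fun t => clog (x, t)).
Proof.
intros x0 t; unfold clog, Re, Im; simpl fst; simpl snd.
split.
- apply (ex_derive_continuous (fun u : R => ln (x ^ 2 + u ^ 2) / 2)); auto_derive; nra.
- apply (ex_derive_continuous (fun u : R => atan (u / x))); auto_derive; lra.
Qed.

Lemma ccont_lam (x : R) : 0 < x -> ccont (fun t => lam (x, t)).
Proof.
intros x0; unfold lam.
apply ccont_minus; [|apply ccont_vline].
apply ccont_mult; [|now apply ccont_clog].
apply ccont_minus; [apply ccont_vline|apply ccont_const].
Qed.

Lemma ccont_del (x : R) : 0 < x -> ccont (fun t => del (x, t)).
Proof.
intros x0; unfold del.
apply ccont_minus; [|apply ccont_const].
apply ccont_mult; [apply ccont_plus; [apply ccont_vline|apply ccont_const]|].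
apply ccont_minus; [|now apply ccont_clog].
apply ccont_ext with (fun t => clog ((x + 1)%R, t)).
- intros t; now rewrite pair_plus_RtoC.
- apply ccont_clog; lra.
Qed.

Lemma ccont_del_sum (x : R) (m : nat) : 0 < x -> ccont (fun t => del_sum (x, t) m).
Proof.
intros x0; induction m as [|m IH]; [exact (ccont_const (RtoC 0))|].
simpl; apply ccont_plus; [exact IH|].
apply ccont_ext with (fun t => del ((x + INR m)%R, t)).
- intros t; now rewrite pair_plus_RtoC.
- apply ccont_del; assert (h := pos_INR m); lra.
Qed.

Lemma continuous_uniform_limit (f : R -> R) (S : nat -> R -> R) (v : nat -> R) (t : R) :
  (forall m u, Rabs (f u - S m u) <= v m) -> is_lim_seq v 0 ->
  (forall m, continuous (S m) t) -> continuous f t.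
Proof.
intros hS hv cS; apply filterlim_locally; intros eps.
assert (e3 : 0 < eps / 3) by (assert (e := cond_pos eps); lra).
apply is_lim_seq_spec in hv; destruct (hv (mkposreal _ e3)) as [M hM].
assert (h := hM M (le_n _)); simpl in h; rewrite Rminus_0_r in h; apply Rabs_def2 in h.
assert (c := cS M).
assert (loc := proj1 (filterlim_locally _ _) c (mkposreal _ e3)).
revert loc; apply filter_imp; intros u hu.
assert (hu' : Rabs (S M u - S M t) < eps / 3) by exact hu.
change (Rabs (f u - f t) < eps).
assert (h1 := hS M u); assert (h2 := hS M t).
revert hu' h1 h2; unfold Rabs; repeat destruct Rcase_abs; lra.
Qed.

(** The tail bound [1 / (6 (m + 1))] does not depend on [t], so the continuous partial sums converge
    uniformly on the line. *)
Lemma ccont_Dl (x : R) : 1 <= x -> ccont (fun t => Dl (x, t)).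
Proof.
intros x1 t.
assert (v0 : is_lim_seq (fun m => / 6 * / INR (S m)) 0).
{ replace (Finite 0) with (Rbar_mult (/ 6) 0) by (simpl; f_equal; ring).
  apply is_lim_seq_scal_l, lim_inv_S. }
split.
- apply (continuous_uniform_limit _ (fun m u => Re (del_sum (x, u) m))
           (fun m => / 6 * / INR (S m))); [|exact v0|].
  + intros m u; apply Dl_lim; exact x1.
  + intros m; exact (proj1 (ccont_del_sum x m ltac:(lra) t)).
- apply (continuous_uniform_limit _ (fun m u => Im (del_sum (x, u) m))
           (fun m => / 6 * / INR (S m))); [|exact v0|].
  + intros m u; apply Dl_lim; exact x1.
  + intros m; exact (proj2 (ccont_del_sum x m ltac:(lra) t)).
Qed.

Lemma ccont_Gamma (sg : R) : admissible sg -> ccont (fun t => Gamma (sg, t)).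
Proof.
intros [hs [s0 _]].
apply ccont_ext with (fun t => cexp (lam ((sg + 2)%R, t) + stirling_const + Dl ((sg + 2)%R, t))
                               * / ((sg, t) * ((sg + 1)%R, t)))%C.
- intros t; rewrite Gamma_formula;
    [now rewrite !pair_plus_RtoC|simpl; lra|].
  intros e; apply (f_equal fst) in e; simpl in e; lra.
- apply ccont_mult.
  + apply ccont_cexp, ccont_plus; [apply ccont_plus|].
    * apply ccont_lam; lra.
    * apply ccont_const.
    * apply ccont_Dl; lra.
  + apply ccont_inv.
    * intros t; apply Cmult_neq_0; intros e; apply (f_equal fst) in e; simpl in e; lra.
    * apply ccont_mult; apply ccont_vline.
Qed.

Lemma ccont_div (f g : R -> C) : (forall t, g t <> RtoC 0) -> ccont f -> ccont g ->
  ccont (fun t => f t / g t)%C.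
Proof. intros h0 hf hg; apply ccont_mult; [exact hf|now apply ccont_inv]. Qed.

Lemma ccont_rcpow (a : R) (f : R -> C) : ccont f -> ccont (fun t => rcpow a (f t)).
Proof.
intros hf; apply ccont_cexp, (ccont_mult f (fun _ => RtoC (ln a))); [exact hf|].
apply ccont_const.
Qed.

Lemma ccont_ccos (f : R -> C) : ccont f -> ccont (fun t => ccos (f t)).
Proof.
intros hf; assert (hi : ccont (fun t => Ci * f t)%C).
{ apply (ccont_mult (fun _ => Ci) f); [apply ccont_const|exact hf]. }
apply (ccont_mult (fun t => cexp (Ci * f t) + cexp (- (Ci * f t)))%C (fun _ => / RtoC 2)%C);
  [|apply ccont_const].
apply ccont_plus; apply ccont_cexp; [exact hi|now apply ccont_opp].
Qed.

Lemma ccont_csin (f : R -> C) : ccont f -> ccont (fun t => csin (f t)).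
Proof.
intros hf; assert (hi : ccont (fun t => Ci * f t)%C).
{ apply (ccont_mult (fun _ => Ci) f); [apply ccont_const|exact hf]. }
apply (ccont_mult (fun t => cexp (Ci * f t) - cexp (- (Ci * f t)))%C
         (fun _ => / (RtoC 2 * Ci))%C); [|apply ccont_const].
apply ccont_minus; apply ccont_cexp; [exact hi|now apply ccont_opp].
Qed.

Lemma ccont_rising (f : R -> C) (m : nat) : ccont f -> ccont (fun t => rising (f t) m).
Proof.
intros hf; induction m as [|m IH]; [exact (ccont_const (RtoC 1))|].
apply (ccont_mult (fun t => rising (f t) m) (fun t => f t + RtoC (INR m))%C); [exact IH|].
apply (ccont_plus f (fun _ => RtoC (INR m))); [exact hf|apply ccont_const].
Qed.

Lemma ccont_integrand (p n r1 r2 : nat) (D : ssrint.int) (w sg : R) : admissible sg ->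
  ccont (fun t => integrand p n r1 r2 D w (sg, t)).
Proof.
intros adm.
assert (nz := fun t => factors_neq0 sg t p adm).
assert (cl := ccont_vline sg).
assert (carg : ccont (fun t => RtoC PI * (sg, t) / RtoC 2)%C).
{ apply (ccont_mult (fun t => RtoC PI * (sg, t))%C (fun _ => / RtoC 2)%C);
    [|apply ccont_const].
  apply (ccont_mult (fun _ => RtoC PI) (fun t => (sg, t))); [apply ccont_const|exact cl]. }
assert (cf : ccont (fun t => fe_factor n r1 r2 D (sg, t))).
{ assert (c1 : ccont (fun t => (rcpow 2 (RtoC 1 - (sg, t)) / rcpow PI (sg, t)) ^ n)%C).
  { apply (ccont_pow (fun t => rcpow 2 (RtoC 1 - (sg, t)) / rcpow PI (sg, t))%C).
    apply (ccont_div (fun t => rcpow 2 (RtoC 1 - (sg, t))) (fun t => rcpow PI (sg, t))).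
    - intros t; apply rcpow_neq0.
    - apply (ccont_rcpow 2 (fun t => RtoC 1 - (sg, t))%C).
      apply (ccont_minus (fun _ => RtoC 1) (fun t => (sg, t))); [apply ccont_const|exact cl].
    - now apply (ccont_rcpow PI (fun t => (sg, t))). }
  assert (c2 : ccont (fun t => rcpow (INR (ssrint.absz D)) ((sg, t) - RtoC (1 / 2)))%C).
  { apply (ccont_rcpow _ (fun t => (sg, t) - RtoC (1 / 2))%C).
    apply (ccont_minus (fun t => (sg, t)) (fun _ => RtoC (1 / 2))); [exact cl|].
    apply ccont_const. }
  assert (c3 := ccont_pow _ (r1 + r2) (ccont_ccos _ carg)).
  assert (c4 := ccont_pow _ r2 (ccont_csin _ carg)).
  assert (c5 := ccont_pow _ n (ccont_Gamma sg adm)).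
  exact (ccont_mult _ _ (ccont_mult _ _ (ccont_mult _ _ (ccont_mult _ _ c1 c2) c3) c4) c5). }
apply (ccont_mult
  (fun t => rcpow w ((sg, t) + RtoC (INR p)) / rising (sg, t) (S p))%C
  (fun t => / fe_factor n r1 r2 D (sg, t))%C).
- apply (ccont_div (fun t => rcpow w ((sg, t) + RtoC (INR p)))%C
           (fun t => rising (sg, t) (S p))); [apply nz| |].
  + apply (ccont_rcpow w (fun t => (sg, t) + RtoC (INR p))%C).
    apply (ccont_plus (fun t => (sg, t)) (fun _ => RtoC (INR p))); [exact cl|].
    apply ccont_const.
  + now apply (ccont_rising (fun t => (sg, t))).
- apply (ccont_inv (fun t => fe_factor n r1 r2 D (sg, t))); [|exact cf].
  intros t; destruct (nz t) as [_ [nc [ns ng]]]; unfold fe_factor.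
  repeat apply Cmult_neq_0; try (apply Cpow_nz; auto); try apply rcpow_neq0.
  unfold Cdiv, rcpow; rewrite <- cexp_opp, <- cexp_add; apply cexp_neq0.
Qed.

(** * Symmetry under conjugation and reduction to a half-line *)

Lemma Cconj_RtoC (r : R) : Cconj (RtoC r) = RtoC r.
Proof. apply C_ext; simpl; ring. Qed.

Lemma Cconj_pair (x y : R) : Cconj (x, y) = (x, (- y)%R).
Proof. reflexivity. Qed.

Lemma Cconj_inv (a : C) : Cconj (/ a)%C = (/ Cconj a)%C.
Proof.
destruct a as [x y]; apply C_ext; simpl;
  replace (- y * (- y * 1)) with (y * (y * 1)) by ring; unfold Rdiv; ring.
Qed.

Lemma Cconj_div (a b : C) : Cconj (a / b)%C = (Cconj a / Cconj b)%C.
Proof. unfold Cdiv; now rewrite Cmult_conj, Cconj_inv. Qed.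

Lemma Cconj_cexp (a : C) : Cconj (cexp a) = cexp (Cconj a).
Proof.
destruct a; unfold cexp; apply C_ext; simpl; rewrite ?cos_neg, ?sin_neg; ring.
Qed.

Lemma Cconj_rcpow (a : R) (s : C) : Cconj (rcpow a s) = rcpow a (Cconj s).
Proof. unfold rcpow; now rewrite Cconj_cexp, Cmult_conj, Cconj_RtoC. Qed.

Lemma Cconj_rising (s : C) (m : nat) : Cconj (rising s m) = rising (Cconj s) m.
Proof.
induction m as [|m IH]; simpl; [apply Cconj_RtoC|].
now rewrite Cmult_conj, Cplus_conj, Cconj_RtoC, IH.
Qed.

Lemma Cconj_ccos (s : C) : Cconj (ccos s) = ccos (Cconj s).
Proof.
destruct s as [x y]; rewrite Cconj_pair, !ccos_coord, Cconj_pair.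
apply C_ext; simpl; rewrite !Ropp_involutive; field.
Qed.

Lemma Cconj_csin (s : C) : Cconj (csin s) = csin (Cconj s).
Proof.
destruct s as [x y]; rewrite Cconj_pair, !csin_coord, Cconj_pair.
apply C_ext; simpl; rewrite !Ropp_involutive; field.
Qed.

Lemma Cconj_Gamma (s : C) : Cconj (Gamma s) = Gamma (Cconj s).
Proof.
assert (e : forall k, gamma_seq (Cconj s) k = Cconj (gamma_seq s k)).
{ intros k; unfold gamma_seq.
  now rewrite Cconj_div, Cmult_conj, Cconj_RtoC, Cconj_rcpow, Cconj_rising. }
apply C_ext.
- change (real (Lim_seq (fun k => Re (gamma_seq s k)))
          = real (Lim_seq (fun k => Re (gamma_seq (Cconj s) k)))).
  f_equal; apply Lim_seq_ext; intros k; now rewrite e.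
- change (- real (Lim_seq (fun k => Im (gamma_seq s k)))
          = real (Lim_seq (fun k => Im (gamma_seq (Cconj s) k)))).
  rewrite (Lim_seq_ext (fun k => Im (gamma_seq (Cconj s) k))
             (fun k => - Im (gamma_seq s k))) by (intros k; now rewrite e).
  rewrite Lim_seq_opp; destruct (Lim_seq _); simpl; ring.
Qed.

Lemma Cconj_integrand (p n r1 r2 : nat) (D : ssrint.int) (w : R) (s : C) :
  Cconj (integrand p n r1 r2 D w s) = integrand p n r1 r2 D w (Cconj s).
Proof.
unfold integrand, fe_factor.
rewrite Cmult_conj, Cconj_div, Cconj_inv, Cconj_rcpow, Cconj_rising.
rewrite !Cmult_conj, !Cpow_conj, Cconj_div, !Cconj_rcpow, Cconj_ccos, Cconj_csin.
now rewrite Cconj_Gamma, Cconj_div, Cmult_conj, Cminus_conj, Cminus_conj, Cplus_conj, !Cconj_RtoC.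
Qed.

Lemma is_RInt_odd (f : R -> R) (T : R) : (forall t, continuous f t) ->
  (forall t, f (- t) = - f t) -> is_RInt f (- T) T 0.
Proof.
intros cf hf.
set (I := RInt f 0 T : R).
assert (i : is_RInt f 0 T I).
{ apply (RInt_correct (V := R_CompleteNormedModule)).
  apply (ex_RInt_continuous (V := R_CompleteNormedModule)); auto. }
assert (j : is_RInt f (- T) 0 (- I)).
{ apply (is_RInt_ext (fun y => opp (f (- y)))).
  - intros x _; rewrite hf; unfold opp; simpl; ring.
  - apply (is_RInt_comp_opp f); rewrite Ropp_involutive, Ropp_0.
    now apply (is_RInt_swap (V := R_NormedModule)). }
evar_last; [apply (is_RInt_Chasles (V := R_NormedModule) f (- T) 0 T (- I) I j i)|].
unfold plus; simpl; ring.
Qed.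

Lemma is_RInt_even (f : R -> R) (T : R) : (forall t, continuous f t) ->
  (forall t, f (- t) = f t) -> is_RInt f (- T) T (2 * RInt f 0 T).
Proof.
intros cf hf.
set (I := RInt f 0 T : R).
assert (i : is_RInt f 0 T I).
{ apply (RInt_correct (V := R_CompleteNormedModule)).
  apply (ex_RInt_continuous (V := R_CompleteNormedModule)); auto. }
assert (j : is_RInt f (- T) 0 I).
{ apply (is_RInt_ext (fun y => opp (opp (f (- y))))).
  - intros x _; rewrite hf; unfold opp; simpl; ring.
  - replace I with (opp (opp I)) by (unfold opp; simpl; ring).
    apply (is_RInt_opp (V := R_NormedModule)), (is_RInt_comp_opp f).
    rewrite Ropp_involutive, Ropp_0; now apply (is_RInt_swap (V := R_NormedModule)). }
evar_last; [apply (is_RInt_Chasles (V := R_NormedModule) f (- T) 0 T I I j i)|].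
unfold plus, I; simpl; lra.
Qed.

(** With [ds = i dt] the integrand has coordinates [- Im g], odd in [t], and [Re g], even in [t].
    Division by [2 pi i] then leaves the real number [I / pi]. *)
Lemma vline_integral_real (g : C -> C) (c I : R) :
  ccont (fun t => g (c, t)) -> (forall s, Cconj (g s) = g (Cconj s)) ->
  filterlim (fun T => RInt (fun t => Re (g (c, t))) 0 T) (Rbar_locally p_infty) (locally I) ->
  is_vline_integral g c (0, (2 * I)%R).
Proof.
intros cg hg hI.
exists (fun T => (0, (2 * RInt (fun t => Re (g (c, t))) 0 T)%R) : C); split.
- intros T T0.
  assert (e : forall t, (RtoC c + Ci * RtoC t)%C = (c, t)) by (intros; apply C_ext; simpl; ring).
  apply (is_RInt_ext (V := C_R_NormedModule)
           (fun t => ((- Im (g (c, t)))%R, Re (g (c, t))) : C)).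
  + intros t _; rewrite e; apply C_ext; unfold Re, Im; simpl; ring.
  + apply (is_RInt_fct_extend_pair (U := R_NormedModule) (V := R_NormedModule)
             (fun t => (- Im (g (c, t)), Re (g (c, t))))); simpl.
    * apply is_RInt_odd.
      -- intros t; apply (continuous_opp (fun u => Im (g (c, u)))), cg.
      -- intros t; rewrite <- Cconj_pair, <- hg; reflexivity.
    * apply (is_RInt_even (fun t => Re (g (c, t)))).
      -- intros t; exact (proj1 (cg t)).
      -- intros t; now rewrite <- Cconj_pair, <- hg.
- intros P [eps hP].
  assert (e2 : 0 < eps / 2) by (assert (e := cond_pos eps); lra).
  assert (b := proj1 (filterlim_locally _ _) hI (mkposreal _ e2)).
  unfold filtermap; revert b; apply filter_imp; intros T hT; apply hP; split; simpl.
  + apply ball_center.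
  + assert (hT' : Rabs (RInt (fun t => Re (g (c, t))) 0 T - I) < eps / 2) by exact hT.
    change (Rabs (2 * RInt (fun t => Re (g (c, t))) 0 T - 2 * I) < eps).
    replace (_ - 2 * I) with (2 * (RInt (fun t => Re (g (c, t))) 0 T - I)) by ring.
    rewrite Rabs_mult, (Rabs_pos_eq 2); lra.
Qed.

Lemma vline_integral_exists (p n r1 r2 : nat) (D : ssrint.int) (w sg : R) :
  (2 <= n)%nat -> (p <= n)%nat -> (r1 + 2 * r2 = n)%nat -> admissible sg ->
  INR n * (1 / 2 - sg) = INR p + 1 / 2 ->
  exists l : C, is_vline_integral (integrand p n r1 r2 D w) sg l /\
    Cmod (/ (RtoC 2 * RtoC PI * Ci) * l)%C <=
      exp (log_bound p n D w sg) * (18 * INR n + 13) / PI.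
Proof.
intros n2 pn hn adm hsg.
assert (N2 : 2 <= INR n) by (apply (le_INR 2); exact n2).
assert (ci := ccont_integrand p n r1 r2 D w sg adm).
assert (s1 : -1 < sg) by (destruct adm; lra).
assert (Z1 : forall t, 1 <= Cmod ((sg + 2)%R, t)).
{ intros t; eapply Rle_trans; [|apply Cmod_ge_re]; rewrite Rabs_pos_eq; lra. }
assert (bnd : forall t, 0 <= t -> Rabs (Re (integrand p n r1 r2 D w (sg, t))) <=
   exp (log_bound p n D w sg) * / sqrt (Cmod ((sg + 2)%R, t))).
{ intros t t0; eapply Rle_trans; [apply re_le_Cmod|].
  apply Cmod_integrand_le; trivial; lia. }
assert (e0 := exp_pos (log_bound p n D w sg)).
destruct (improper_osc (fun t => Re (integrand p n r1 r2 D w (sg, t)))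
  (exp (log_bound p n D w sg)) (exp (main_log p n D w sg)) (INR n)
  (stationary n D w) (phase_shift p n r2 sg)) as [I [hI bI]].
- exact N2.
- apply exp_pos.
- split; [apply Rlt_le, exp_pos|apply exp_le, main_log_le; lra].
- intros t; exact (proj1 (ci t)).
- intros t ht; eapply Rle_trans; [apply bnd; lra|].
  rewrite <- (Rmult_1_r (exp _)) at 2; apply Rmult_le_compat_l; [lra|].
  rewrite <- Rinv_1; apply Rinv_le_contravar; [lra|].
  rewrite <- sqrt_1; apply sqrt_le_1_alt, Z1.
- intros t ht; eapply Rle_trans; [apply bnd; lra|].
  apply Rmult_le_compat_l; [lra|]; apply Rinv_le_contravar; [apply sqrt_lt_R0; lra|].
  apply sqrt_le_1_alt; eapply Rle_trans; [|apply Cmod_ge_im]; apply Rle_abs.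
- intros t ht; now apply integrand_osc.
- exists (0, (2 * I)%R); split.
  + apply vline_integral_real; [exact ci| |exact hI].
    intros s; apply Cconj_integrand.
  + assert (p0 := PI_RGT_0).
    replace (/ (RtoC 2 * RtoC PI * Ci) * (0, (2 * I)%R))%C with (RtoC (I / PI)).
    * unfold Rdiv; rewrite Cmod_R, Rabs_mult, (Rabs_pos_eq (/ PI)).
      -- apply Rmult_le_compat_r; [|exact bI]; now apply Rlt_le, Rinv_0_lt_compat.
      -- now apply Rlt_le, Rinv_0_lt_compat.
    * apply C_ext; simpl; field; lra.
Qed.

(** * Final estimates *)

Lemma sin_PI8_ge : 1 / 4 <= sin (PI / 8).
Proof.
assert (p := PI_RGT_0).
assert (e : sin (PI / 4) = 2 * sin (PI / 8) * cos (PI / 8)).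
{ rewrite <- sin_2a; f_equal; field. }
assert (s0 : 0 < sin (PI / 8)) by (apply sin_gt_0; lra).
assert (s4 : 1 / 2 <= sin (PI / 4)).
{ rewrite <- sin_PI6; apply sin_incr_1; lra. }
assert (c := COS_bound (PI / 8)); nra.
Qed.

(** [pi |sg| / 2] lies between [pi / 8] and [3 pi / 8], where sine and cosine are at least
    [sin (pi / 8)]. For [n >= 2] both abscissas meet these bounds. *)
Lemma admissible_Rabs (sg : R) : -3 / 4 <= sg < 1 / 2 -> 1 / 4 <= Rabs sg -> admissible sg.
Proof.
intros hs ha.
assert (p := PI_RGT_0); assert (q := sin_PI8_ge).
set (x := PI * Rabs sg / 2).
assert (ax : Rabs sg <= 3 / 4) by (apply Rabs_le; lra).
assert (hx : PI / 8 <= x <= 3 * (PI / 8)) by (unfold x; split; nra).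
assert (hc : 1 / 4 <= cos x).
{ apply Rle_trans with (cos (3 * (PI / 8))); [|apply cos_decr_1; lra].
  replace (3 * (PI / 8)) with (PI / 2 - PI / 8) by field; rewrite cos_shift; lra. }
assert (hn : 1 / 4 <= sin x).
{ eapply Rle_trans; [exact q|]; apply sin_incr_1; lra. }
repeat split; try lra.
- intros e; rewrite e, Rabs_R0 in ha; lra.
- apply Rle_trans with (cos x); [exact hc|].
  unfold x, Rabs; destruct Rcase_abs.
  + replace (PI * - sg / 2) with (- (PI * sg / 2)) by field; rewrite cos_neg; apply Rle_abs.
  + apply Rle_abs.
- apply Rle_trans with (sin x); [exact hn|].
  unfold x, Rabs at 1; destruct Rcase_abs.
  + replace (PI * - sg / 2) with (- (PI * sg / 2)) by field; rewrite sin_neg.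
    rewrite <- Rabs_Ropp; apply Rle_abs.
  + apply Rle_abs.
Qed.

(** The exponent is the room left in [absorb_constants]: [(n sg + n / 2 + 2) - (n sg + 2 n) = 2 - 3
    n / 2] for the powers of 2, and [9 n / 2 - 4 n / 3 = 19 n / 6] for those of [e]. *)
Lemma numeric_slack (N : R) : 2 <= N ->
  18 * N + 13 <= exp (19 / 6 * N + (2 - 3 / 2 * N) * ln 2) * sqrt (3 * N).
Proof.
intros N2.
assert (l1 := ln_le_sub1 2 ltac:(lra)); assert (l2 := ln_lt_2).
assert (s : 12 / 5 <= sqrt (3 * N)).
{ rewrite <- (sqrt_square (12 / 5)) by lra; apply sqrt_le_1_alt; lra. }
(* As [1/2 < ln 2 <= 1], the exponent is at least [X = 5 N / 3 + 1], and [exp X >= (1 + X / 8)^8].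
   Of the eight factors, six are replaced by their value at [N = 2], where [q = 37/24], and the
   other two by the tangent of the square there, which leaves an inequality linear in [N]. *)
set (q := 1 + (5 / 3 * N + 1) / 8).
assert (e : q ^ 8 <= exp (19 / 6 * N + (2 - 3 / 2 * N) * ln 2)).
{ apply Rle_trans with (exp (INR 8 * ((5 / 3 * N + 1) / 8))).
  - rewrite <- exp_pow_INR; apply pow_incr; split; [unfold q; lra|].
    apply exp_ineq1_le.
  - apply exp_le; simpl; nra. }
assert (q0 : 37 / 24 <= q) by (unfold q; lra).
assert (q6 : 13 <= q ^ 6).
{ apply Rle_trans with ((37 / 24) ^ 6); [lra|]; apply pow_incr; lra. }
assert (q2 : 37 / 12 * q - (37 / 24) ^ 2 <= q ^ 2).
{ assert (h := pow2_ge_0 (q - 37 / 24)); lra. }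
apply Rle_trans with (13 * (37 / 12 * q - (37 / 24) ^ 2) * (12 / 5)).
- unfold q; lra.
- apply Rmult_le_compat; try lra.
  eapply Rle_trans; [|exact e].
  replace (q ^ 8) with (q ^ 6 * q ^ 2) by ring.
  apply Rmult_le_compat; lra.
Qed.

Lemma vline_integral_ext (f g : C -> C) (c : R) (l : C) :
  (forall s, f s = g s) -> is_vline_integral f c l -> is_vline_integral g c l.
Proof.
intros e [J [h1 h2]]; exists J; split; [|exact h2]; intros T T0.
apply (is_RInt_ext (V := C_R_NormedModule) (fun t => f (RtoC c + Ci * RtoC t)%C * Ci)%C);
  [intros t _; now rewrite e|now apply h1].
Qed.

(* The exponents of [w], [|D|] and [pi] agree exactly on both
   sides; only powers of [2] and [e] leave room. *)
Lemma absorb_constants (p n : nat) (D : ssrint.int) (w sg : R) (a b g : R) :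
  (2 <= n)%nat ->
  INR n * sg + INR n / 2 + 2 = a ->
  INR n * sg = b + 1 ->
  INR n * (sg + 9 / 2) <= g ->
  exp (log_bound p n D w sg) * (18 * INR n + 13) / PI <=
  Rpower 2 a * Rpower PI b * exp g * sqrt (3 * INR n)
  * Rpower (INR (ssrint.absz D)) (1 / 2 - sg) * Rpower w (sg + INR p).
Proof.
intros n2 ha hb hg.
assert (N2 : 2 <= INR n) by (apply (le_INR 2); exact n2).
assert (num := numeric_slack (INR n) N2).
assert (p0 := PI_RGT_0).
assert (l8 : ln 8 = 3 * ln 2).
{ replace 8 with (2 ^ 3) by ring; rewrite ln_pow by lra; simpl; ring. }
assert (ipi : / PI = exp (- ln PI)) by (rewrite exp_Ropp, exp_ln; trivial).
unfold Rdiv, Rpower; rewrite ipi.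
apply Rle_trans with (exp (log_bound p n D w sg)
  * (exp (19 / 6 * INR n + (2 - 3 / 2 * INR n) * ln 2) * sqrt (3 * INR n)) * exp (- ln PI)).
- apply Rmult_le_compat_r; [apply Rlt_le, exp_pos|].
  apply Rmult_le_compat_l; [apply Rlt_le, exp_pos|exact num].
- set (S := sqrt (3 * INR n)).
  assert (S0 : 0 <= S) by apply sqrt_pos.
  replace (exp (log_bound p n D w sg)
    * (exp (19 / 6 * INR n + (2 - 3 / 2 * INR n) * ln 2) * S) * exp (- ln PI)) with
    (exp (log_bound p n D w sg + (19 / 6 * INR n + (2 - 3 / 2 * INR n) * ln 2) + - ln PI) * S)
    by (rewrite !exp_plus; ring).
  match goal with |- _ <= ?u * ?v * ?x * S * ?y * ?z =>
    replace (u * v * x * S * y * z) with (u * v * x * y * z * S) by ring end.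
  rewrite <- !exp_plus; apply Rmult_le_compat_r; [exact S0|]; apply exp_le.
  unfold log_bound; rewrite l8, <- ha.
  replace b with (INR n * sg - 1) by lra.
  nra.
Qed.

Lemma kernel_bound (n r1 r2 : nat) (D : ssrint.int) (w : R) :
  (2 <= n)%nat -> (r1 + 2 * r2 = n)%nat ->
  exists k : C, is_kernel n r1 r2 D w k /\
    Cmod k <= Q2 n * Rpower (INR (ssrint.absz D)) (1 + 1 / (2 * INR n))
              * Rpower w (INR n - 1 / 2 - 1 / (2 * INR n)).
Proof.
intros n2 hn.
assert (N2 : 2 <= INR n) by (apply (le_INR 2); exact n2).
set (sg := - (1 / 2) - 1 / (2 * INR n)).
assert (sN : INR n * sg = - (INR n / 2) - 1 / 2) by (unfold sg; field; lra).
assert (hs : - 3 / 4 <= sg < - (1 / 2)) by nra.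
assert (adm : admissible sg).
{ apply admissible_Rabs; [lra|]; rewrite Rabs_left; lra. }
destruct (vline_integral_exists n n r1 r2 D w sg n2 (le_n n) hn adm ltac:(lra))
  as [l [hl bl]].
exists (/ (RtoC 2 * RtoC PI * Ci) * l)%C; split; [now exists l|].
eapply Rle_trans; [exact bl|].
eapply Rle_trans.
- apply (absorb_constants n n D w sg (3 / 2) (- (INR n / 2) - 3 / 2) (4 * INR n - 1 / 2)).
  all: try assumption; try lra.
- replace (1 / 2 - sg) with (1 + 1 / (2 * INR n)) by (unfold sg; field; lra).
  replace (sg + INR n) with (INR n - 1 / 2 - 1 / (2 * INR n)) by (unfold sg; field; lra).
  apply Rle_refl.
Qed.

Lemma kernel_deriv_bound (n r1 r2 : nat) (D : ssrint.int) (w : R) :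
  (2 <= n)%nat -> (r1 + 2 * r2 = n)%nat ->
  exists k : C, is_kernel_deriv n r1 r2 D w k /\
    Cmod k <= Q3 n * Rpower (INR (ssrint.absz D)) (1 / (2 * INR n))
              * Rpower w (1 / 2 - 1 / (2 * INR n)).
Proof.
intros n2 hn.
assert (N2 : 2 <= INR n) by (apply (le_INR 2); exact n2).
set (sg := 1 / 2 - 1 / (2 * INR n)).
assert (sN : INR n * sg = INR n / 2 - 1 / 2) by (unfold sg; field; lra).
assert (hs : 1 / 4 <= sg < 1 / 2) by nra.
assert (adm : admissible sg).
{ apply admissible_Rabs; [lra|]; rewrite Rabs_pos_eq; lra. }
destruct (vline_integral_exists 0 n r1 r2 D w sg n2 ltac:(lia) hn adm ltac:(simpl; lra))
  as [l [hl bl]].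
exists (/ (RtoC 2 * RtoC PI * Ci) * l)%C; split.
- exists l; [|reflexivity]; revert hl; apply vline_integral_ext; intros s.
  unfold integrand; simpl rising; simpl INR.
  now rewrite !Cplus_0_r, Cmult_1_l.
- eapply Rle_trans; [exact bl|].
  eapply Rle_trans.
  + apply (absorb_constants 0 n D w sg (INR n + 3 / 2) (INR n / 2 - 3 / 2)
             (INR n * (1 + 4 * INR n / (INR n - 1)) - 1 / 2)); try assumption; try lra.
    (* The estimate yields the exponent [5 n - 1/2], dominated by that of [Q3] because
       [4 n / (n - 1) >= 4]. *)
    enough (4 <= 4 * INR n / (INR n - 1)) by nra.
    apply (Rmult_le_reg_r (INR n - 1)); [lra|].
    unfold Rdiv; rewrite Rmult_assoc, Rinv_l; lra.
  + simpl INR; rewrite Rplus_0_r.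
    replace (1 / 2 - sg) with (1 / (2 * INR n)) by (unfold sg; field; lra).
    apply Rle_refl.
Qed.

(** * Counting the complex embeddings *)

From HB Require Import structures.
From mathcomp Require Import all_boot all_order all_algebra all_field.
From Stdlib Require Import Reals Classical.
From Coquelicot Require Import Coquelicot.

Section Embeddings.
Import GRing.Theory.
Local Open Scope ring_scope.

Definition ratK (K : fieldExtType rat) (p : {poly rat}) : {poly K} := map_poly (in_alg K) p.
Definition ratC (p : {poly rat}) : {poly algC} := map_poly ratr p.

Lemma rmorph_rat_horner (K : fieldExtType rat) (phi : {rmorphism K -> algC})
    (p : {poly rat}) (a : K) :
  phi (ratK K p).[a] = (ratC p).[phi a].
Proof.
rewrite -horner_map; congr (_.[_]); rewrite /ratK /ratC -map_poly_comp.
by apply: eq_map_poly => y /=; rewrite -(fmorph_eq_rat (phi \o in_alg K)).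
Qed.

(** Characteristic zero gives separability, hence a primitive element. Its minimal polynomial is
    pulled back to rational coefficients so that it can be read both in [K] and in [algC]. *)
Lemma primitive_generator (K : fieldExtType rat) : {a : K & {q : {poly rat} |
  [/\ separable_poly q, size q = (\dim {:K}).+1, root (ratK K q) a,
      forall p, root (ratK K p) a -> q %| p
    & forall x, exists p, x = (ratK K p).[a]]}}.
Proof.
have ch0 : [pchar K] =i pred0 by move=> p; rewrite (pchar_lalg K) Num.Theory.pchar_num.
have sepK : separable 1 {:K} by apply/separableP => y _; apply: pcharf0_separable.
have gen := eq_adjoin_separable_generator sepK (sub1v _).
set a := separable_generator _ _ in gen; exists a.
have sepa : separable_element 1 a by exact: separable_generatorP.
have /sig_eqW[q minq] : exists q, minPoly 1 a = ratK K q.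
  by apply/polyOver1P/minPolyOver.
exists q; split.
- by move: sepa; rewrite /separable_element minq separable_map.
- have := size_minPoly 1 a; rewrite minq size_map_poly => ->.
  by rewrite gen dim_Fadjoin dimv1 muln1.
- by rewrite -minq root_minPoly.
- move=> p pa; rewrite -(dvdp_map (in_alg K)) -/(ratK K q) -minq.
  by apply: minPoly_dvdp pa; apply/polyOver1P; exists p.
- move=> x; have : x \in <<1; a>>%VS by rewrite -gen memvf.
  by case/Fadjoin_polyP => P /polyOver1P[p ->] ->; exists p.
Qed.

(** Each [x] is [p(a)] for a chosen [p] and is sent to [p(r)]. The choice is immaterial: two choices
    differ by a multiple of [q], which vanishes at [r]. *)
Lemma embedding_of_root (K : fieldExtType rat) (a : K) (q : {poly rat}) (r : algC) :
    (forall p, root (ratK K p) a -> q %| p) ->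
    (forall x, exists p, x = (ratK K p).[a]) ->
  root (ratC q) r -> exists phi : {rmorphism K -> algC}, phi a = r.
Proof.
move=> minq gen qr.
have genb x : exists p, x == (ratK K p).[a] by have [p ->] := gen x; exists p.
pose P x := xchoose (genb x); pose f x := (ratC (P x)).[r].
have fE p : f (ratK K p).[a] = (ratC p).[r].
  apply/eqP; rewrite /f -subr_eq0 -hornerN -hornerD /ratC -rmorphB.
  apply: (@root_dvdp _ (ratC q)) qr; rewrite dvdp_map; apply: minq.
  rewrite /root /ratK rmorphB hornerD hornerN subr_eq0 eq_sym.
  by apply/eqP; rewrite -{1}(eqP (xchooseP (genb (ratK K p).[a]))).
have fB : zmod_morphism f.
  move=> x y; have [[p ->] [p' ->]] := (gen x, gen y).
  by rewrite -hornerN -hornerD /ratK -rmorphB !fE /ratC rmorphB hornerD hornerN.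
have fM : monoid_morphism f.
  split=> [|x y].
    by have := fE 1; rewrite /ratK /ratC !rmorph1 !hornerC.
  have [[p ->] [p' ->]] := (gen x, gen y).
  by rewrite -hornerM /ratK -rmorphM !fE /ratC rmorphM hornerM.
pose fa := GRing.isZmodMorphism.Build _ _ f fB.
pose fm := GRing.isMonoidMorphism.Build _ _ f fM.
pose phi : {rmorphism K -> algC} := HB.pack f fa fm.
exists phi; rewrite -[a in phi a](hornerX a) -(map_polyX (in_alg K)).
by rewrite [LHS]fE /ratC map_polyX hornerX.
Qed.

(** Evaluation at a primitive element is a bijection from the embeddings onto the roots of its
    separable minimal polynomial. This is where the relation [r1 + 2 r2 = n], on which the
    cancellation of exponentials rests, comes from. *)
Lemma signature_degree (K : fieldExtType rat) (r1 r2 : nat) :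
  has_signature K r1 r2 -> addn r1 r2.*2 = \dim {:K}.
Proof.
case=> [[f [fR finj fsurj]] [g [gC ginj gsurj]]].
have [a [q [sepq szq qa minq gen]]] := primitive_generator K.
have eq_at_a (u v : {rmorphism K -> algC}) : u a = v a -> u =1 v.
  by move=> uv x; have [p ->] := gen x; rewrite !rmorph_rat_horner uv.
have [rs qrs] := closed_field_poly_normal (ratC q).
have q0 : q != 0 by rewrite -size_poly_eq0 szq.
have lc0 : lead_coef (ratC q) != 0 by rewrite lead_coef_eq0 map_poly_eq0.
have rsP z : (z \in rs) = root (ratC q) z by rewrite qrs rootZ // root_prod_XsubC.
have uniq_rs : uniq rs.
  rewrite -separable_prod_XsubC -(eqp_separable (eqp_scale _ lc0)) -qrs.
  by rewrite separable_map.
have size_rs : size rs = \dim {:K}.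
  apply: succn_inj; rewrite -szq -(size_map_poly (ratr : {rmorphism rat -> algC})).
  by rewrite -/(ratC q) qrs size_scale // size_prod_XsubC.
have emb_root (u : {rmorphism K -> algC}) : u a \in rs.
  by rewrite rsP /root -rmorph_rat_horner (eqP qa) rmorph0.
pose s := [seq f i a | i : 'I_r1] ++ [seq g j a | j : 'I_(r2.*2)].
have uniq_s : uniq s.
  have injf : injective (fun i => f i a) by move=> i j e; apply: finj (eq_at_a _ _ e).
  have injg : injective (fun j => g j a) by move=> i j e; apply: ginj (eq_at_a _ _ e).
  rewrite cat_uniq (map_inj_uniq injf) (map_inj_uniq injg) !enum_uniq andbT.
  apply/hasPn => _ /mapP[j _ ->]; apply/negP => /mapP[i _ e].
  by apply: (gC j) => x; rewrite (eq_at_a _ _ e); apply: fR.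
have -> : addn r1 r2.*2 = size s.
  have sz m : size (Finite.enum 'I_m) = m.
    by rewrite -[RHS](size_enum_ord m) [enum 'I_m]enumT.
  by rewrite size_cat !size_map (sz r1) (sz r2.*2).
transitivity (size rs) => //.
apply/eqP; rewrite eqn_leq; apply/andP; split; apply: uniq_leq_size => // z.
  by rewrite mem_cat => /orP[] /mapP[i _ ->]; apply: emb_root.
rewrite rsP => /(embedding_of_root K a q _ minq gen)[u <-]; rewrite mem_cat.
(* Being real quantifies over all of [K], so the case distinction is by excluded middle. *)
have [/fsurj[i e]|/gsurj[j e]] := classic (real_embedding u); apply/orP.
  by left; apply/mapP; exists i; rewrite ?mem_enum.
by right; apply/mapP; exists j; rewrite ?mem_enum.
Qed.

End Embeddings.

Theorem theorem6 (K : fieldExtType rat) (n r1 r2 : nat) (D : int)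
    (hdeg : \dim {:K} = n) (hn : (2 <= n)%nat)
    (hsig : has_signature K r1 r2) (hD : is_discriminant K D)
    (w : R) (hw : 0 < w) :
  (exists k : C, is_kernel n r1 r2 D w k /\
     Cmod k <= Q2 n * Rpower (INR (absz D)) (1 + 1 / (2 * INR n))
               * Rpower w (INR n - 1 / 2 - 1 / (2 * INR n))) /\
  (exists k : C, is_kernel_deriv n r1 r2 D w k /\
     Cmod k <= Q3 n * Rpower (INR (absz D)) (1 / (2 * INR n))
               * Rpower w (1 / 2 - 1 / (2 * INR n))).
Proof.
have n2 : (2 <= n)%coq_nat by apply/leP.
have sig : (r1 + 2 * r2)%coq_nat = n.
  by rewrite -hdeg -(signature_degree _ _ _ hsig) -mul2n.
split; [exact: kernel_bound|exact: kernel_deriv_bound].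
Qed.
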